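(* Assume $\rho>0$, $\rho\ge 2(\tau+\lambda)$, $\beta\in[0,1)$, and let $\theta=1-\beta$. Run the stochastic extrapolated model-based method for $K\ge1$ iterations with $x^1=x^0\in\mathcal X$ and $$\gamma=\gamma_0\theta^{-1}\sqrt K+\lambda+\rho\beta^2\theta^{-3}$$ for some $\gamma_0>0$. Let $z^k=x^k+\frac{\beta}{1-\beta}(x^k-x^{k-1})$, let $\Delta=f_{1/\rho}(x^1)-\min_x f(x)$, and let $k^*$ be an index chosen uniformly at random in $\{1,2,\ldots,K\}$. Then $$\mathbb{E}[\|\nabla f_{1/\rho}(z^{k^{*}})\|^{2}]\le\frac{2\rho}{\rho-\lambda}\bigg[\frac{\rho\beta^{2}\theta^{-2}\Delta}{K}+\Big(\gamma_{0}\Delta+\frac{\rho L^{2}}{\theta\gamma_{0}}\Big)\frac{1}{\sqrt{K}}\bigg].$$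
   Context: Setting: $\mathcal X\subseteq\mathbb R^d$ is a nonempty closed convex set, $\xi$ is a random sample with distribution $\Xi$, and $f(x)=\mathbb E_{\xi\sim\Xi}[f(x,\xi)]$ is to be minimized over $\mathcal X$; $f$ is bounded below, and $\min_x f(x)$ denotes its minimal value over $\mathcal X$. $\|\cdot\|$ is the Euclidean norm. A function $g$ is $\lambda$-weakly convex if $g+\frac{\lambda}{2}\|\cdot\|^2$ is convex. Each $f(\cdot,\xi)$ is continuous and $\mu$-weakly convex with $\mu<\lambda+\tau$. For each $x\in\mathcal X$ and $\xi$ a model function $f_x(\cdot,\xi)$ is given such that, for constants $\lambda\ge 0$, $\tau\ge 0$, $L>0$ and all $\xi\sim\Xi$: (i) for all $x\in\mathcal X$, $y\mapsto f_x(y,\xi)$ is $\lambda$-weakly convex; (ii) $f_x(x,\xi)=f(x,\xi)$ for all $x\in\mathcal X$; (iii) $f_x(y,\xi)-f(y,\xi)\le\frac{\tau}{2}\|x-y\|^2$ for all $x,y\in\mathcal X$; (iv) $f_x(z,\xi)-f_x(y,\xi)\le L\|z-y\|$ for all $x,y,z\in\mathcal X$. Moreau envelope: $f_{1/\rho}(x)=\min_{y\in\mathcal X}\{f(y)+\frac{\rho}{2}\|x-y\|^2\}$ for $x\in\mathbb R^d$; for the $\rho$ considered it is differentiable with $\nabla f_{1/\rho}(x)=\rho(x-\hat x)$, $\hat x=\mathrm{argmin}_{y\in\mathcal X}\{f(y)+\frac{\rho}{2}\|x-y\|^2\}$. Stochastic extrapolated model-based method: given $x^0,x^1\in\mathcal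 X$, $\beta$ and $\gamma$, for $k=1,\dots,K$ draw a fresh independent sample $\xi^k\sim\Xi$ and set $$y^k=x^k+\beta(x^k-x^{k-1}),\qquad x^{k+1}=\mathrm{argmin}_{x\in\mathcal X}\Big\{f_{x^k}(x,\xi^k)+\frac{\gamma}{2}\|x-y^k\|^2\Big\}.$$ The index $k^*$ is independent of the samples, and the expectation is over all randomness. *)

(* Defs.v *)
From HB Require Import structures.
From mathcomp Require Import all_boot all_order all_algebra finmap.
From mathcomp Require Import all_classical all_reals all_analysis.

Set Implicit Arguments.
Unset Strict Implicit.
Unset Printing Implicit Defensive.

Import Order.TTheory GRing.Theory Num.Theory.
Import numFieldNormedType.Exports.

Local Open Scope classical_set_scope.
Local Open Scope ring_scope.

(* The library norm on ['rV[R]_d] is the sup norm, hence this definition; the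
   two norms induce the same topology. *)
Definition enorm (R : realType) (d : nat) (v : 'rV[R]_d) : R :=
  Num.sqrt (\sum_(i < d) v ord0 i ^+ 2).

(* The vector of partial derivatives; ['D] carries no information at a point
   where a partial derivative does not exist. *)
Definition gradient (R : realType) (d : nat) (g : 'rV[R]_d -> R)
    (x : 'rV[R]_d) : 'rV[R]_d :=
  \row_(i < d) 'D_(delta_mx ord0 i) g x.

Definition weakly_convex (R : realType) (d : nat) (X : set 'rV[R]_d) (lam : R)
    (g : 'rV[R]_d -> R) : Prop :=
  convex_function X (fun y => g y + lam / 2 * enorm y ^+ 2).

Definition is_argmin (R : realType) (E : Type) (X : set E) (g : E -> R)
    (x : E) : Prop :=
  X x /\ forall y, X y -> g x <= g y.

Definition objective (R : realType) (dT : measure_display)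
    (T : measurableType dT) (Xi : probability T R) (d : nat)
    (F : 'rV[R]_d -> T -> R) (x : 'rV[R]_d) : R :=
  fine ('E_Xi[F x])%E.

(* The minimal value when it is attained.  [inf] is only meaningful for a
   nonempty set that is bounded below. *)
Definition minval (R : realType) (E : Type) (X : set E) (g : E -> R) : R :=
  inf [set g y | y in X].

(* [moreau X g rho] is the envelope g_{1/rho}. *)
Definition moreau (R : realType) (d : nat) (X : set 'rV[R]_d)
    (g : 'rV[R]_d -> R) (rho : R) (x : 'rV[R]_d) : R :=
  minval X (fun y => g y + rho / 2 * enorm (x - y) ^+ 2).

(* [beta] times the last displacement added to the current point: [y^k] for
   the coefficient beta and [z^k] for the coefficient beta / (1 - beta).  Only
   indices k >= 1 are meaningful. *)
Definition extrapolate (R : realType) (d : nat) (beta : R)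
    (x : nat -> 'rV[R]_d) (k : nat) : 'rV[R]_d :=
  x k + beta *: (x k - x k.-1).

Section independence.
Context {R : realType} {dO : measure_display} {O : measurableType dO}.
Variable P : probability O R.

Definition independent_systems (G H : set_system O) : Prop :=
  forall A B, G A -> H B -> P (A `&` B) = (P A * P B)%E.

Definition mutually_independent (I : choiceType) (D : set I)
    (G : I -> set_system O) : Prop :=
  forall (J : {fset I}) (A : I -> set O),
    (forall i, i \in J -> D i /\ G i (A i)) ->
    P (\bigcap_(i in [set` J]) A i) = (\prod_(i <- J) P (A i))%E.

End independence.

(* The sigma-algebra generated by the samples [xi 1, ..., xi k] (trivial for
   k = 0). *)
Definition history (dO dT : measure_display) (O : measurableType dO)
    (T : measurableType dT) (xi : nat -> O -> T) (k : nat) : set_system O :=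
  <<s \bigcup_(j in [set j | (1 <= j <= k)%N])
        g_sigma_algebra_preimage (xi j) >>.

(* Borel measurability of a random vector with respect to the sigma-algebra
   [G], expressed through its coordinates. *)
Definition vector_measurable (R : realType) (O : Type) (d : nat)
    (G : set_system O) (Y : O -> 'rV[R]_d) : Prop :=
  forall (i : 'I_d) (B : set R), measurable B ->
    G ((fun w => Y w ord0 i) @^-1` B).

(* Main.v *)
(** Put z^k = x^k + beta/(1-beta) (x^k - x^{k-1}) and let p^k be the proximal
    point of z^k.  Since z^{k+1} - z^k = (x^{k+1} - y^k)/theta, comparing x^{k+1}
    with the feasible point beta x^k + theta p^k in the strongly convex
    subproblem bounds |p^k - z^{k+1}|^2 - |p^k - z^k|^2, hence the decrease of
    the Moreau envelope along z^k.  Comparing x^{k+1} with x^k gives the uniform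
    bound |x^{k+1} - x^k| <= L/(gamma0 sqrt K), and it is this bound, rather than
    Young's inequality, that produces the constant rho L^2/(theta gamma0).  The
    remaining squares of displacements telescope, so that along every sample
    path sum_k |z^k - p^k|^2 is at most a constant minus
    theta sum_k [F(x^k,xi^k) - f(x^k) - F(p^k,xi^k) + f(p^k)].  These noise terms
    have mean zero because x^k and p^k depend only on xi^1, ..., xi^{k-1}: the
    path is bounded, so x^k and p^k are uniform limits of finitely valued maps,
    and F(.,s) is equicontinuous uniformly in s. *)

Require Import Defs.
From HB Require Import structures.
From mathcomp Require Import all_boot all_order all_algebra finmap.
From mathcomp Require Import all_classical all_reals all_analysis.
From mathcomp Require Import measurable_realfun ring lra.

Set Implicit Arguments.
Unset Strict Implicit.
Unset Printing Implicit Defensive.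

Import Order.TTheory GRing.Theory Num.Theory.
Import numFieldNormedType.Exports.

Local Open Scope classical_set_scope.
Local Open Scope ring_scope.

(** * Euclidean geometry and weak convexity *)

Section euclidean.
Context {R : realType} {d : nat}.
Implicit Types u v w : 'rV[R]_d.

Definition dot u v : R := \sum_(i < d) u ord0 i * v ord0 i.

Lemma dotC u v : dot u v = dot v u.
Proof. by apply: eq_bigr => i _; rewrite mulrC. Qed.

Lemma dotDl u v w : dot (u + v) w = dot u w + dot v w.
Proof. by rewrite /dot -big_split; apply: eq_bigr => i _; rewrite mxE mulrDl. Qed.

Lemma dotZl a u v : dot (a *: u) v = a * dot u v.
Proof. by rewrite /dot mulr_sumr; apply: eq_bigr => i _; rewrite mxE mulrA. Qed.

Lemma dotDr u v w : dot w (u + v) = dot w u + dot w v.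
Proof. by rewrite dotC dotDl !(dotC w). Qed.

Lemma dotZr a u v : dot u (a *: v) = a * dot u v.
Proof. by rewrite dotC dotZl dotC. Qed.

Lemma dotNl u v : dot (- u) v = - dot u v.
Proof. by rewrite -scaleN1r dotZl mulN1r. Qed.

Lemma dotNr u v : dot u (- v) = - dot u v.
Proof. by rewrite dotC dotNl dotC. Qed.

Definition dotE := (dotDl, dotDr, dotNl, dotNr, dotZl, dotZr).

Lemma dot_ge0 u : 0 <= dot u u.
Proof. by apply: sumr_ge0 => i _; rewrite -expr2 sqr_ge0. Qed.

Lemma enorm_ge0 u : 0 <= enorm u.
Proof. exact: sqrtr_ge0. Qed.

Lemma enorm_sqr u : enorm u ^+ 2 = dot u u.
Proof.
rewrite sqr_sqrtr; first by apply: eq_bigr => i _; rewrite expr2.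
by apply: sumr_ge0 => i _; rewrite sqr_ge0.
Qed.

Lemma enormN u : enorm (- u) = enorm u.
Proof. by congr Num.sqrt; apply: eq_bigr => i _; rewrite mxE sqrrN. Qed.

Lemma enormB u v : enorm (u - v) = enorm (v - u).
Proof. by rewrite -enormN opprB. Qed.

Lemma dotBB u v : dot (u - v) (u - v) = dot (v - u) (v - u).
Proof. by rewrite -opprB dotNl dotNr opprK. Qed.

Lemma dot_young u v : 2 * dot u v <= dot u u + dot v v.
Proof. by have := dot_ge0 (u - v); rewrite !dotE (dotC v u); lra. Qed.

Lemma coord_le_enorm u i : `|u ord0 i| <= enorm u.
Proof.
rewrite -(@ler_pXn2r _ 2%N) ?nnegrE ?enorm_ge0 ?normr_ge0//.
rewrite real_normK ?num_real// enorm_sqr /dot (bigD1 i)//= expr2 lerDl.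
by apply: sumr_ge0 => j _; rewrite -expr2 sqr_ge0.
Qed.

Lemma norm_le_enorm u : `|u| <= enorm u.
Proof.
rewrite [leLHS]/Num.norm/= mx_normrE; apply: bigmax_le => [|[i j] _ /=].
  exact: enorm_ge0.
by rewrite (ord1 i) coord_le_enorm.
Qed.

Lemma coord_le_norm u i : `|u ord0 i| <= `|u|.
Proof.
by rewrite [leRHS]/Num.norm/= mx_normrE; apply/bigmax_geP; right => /=; exists (ord0, i).
Qed.

Lemma enorm_le_norm u : enorm u <= Num.sqrt d%:R * `|u|.
Proof.
rewrite -(@ler_pXn2r _ 2%N) ?nnegrE ?enorm_ge0 ?mulr_ge0 ?sqrtr_ge0//.
rewrite enorm_sqr exprMn sqr_sqrtr// /dot mulr_natl.
have -> : `|u| ^+ 2 *+ d = \sum_(i < d) `|u| ^+ 2 by rewrite sumr_const card_ord.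
apply: ler_sum => i _.
rewrite -expr2 -(@real_normK _ (u ord0 i)) ?num_real//.
by rewrite ler_pXn2r ?nnegrE// coord_le_norm.
Qed.

Variable X : set 'rV[R]_d.

Lemma convex_setE : convex_set X ->
  forall t u v, 0 <= t <= 1 -> X u -> X v -> X (t *: u + (1 - t) *: v).
Proof.
move=> cX t u v /andP[t0 t1] Xu Xv.
by have := cX u v (Itv01 t0 t1); rewrite !inE => /(_ Xu Xv).
Qed.

(** The squared norm satisfies t|u|^2 + (1-t)|v|^2 - |tu + (1-t)v|^2 = t(1-t)|u-v|^2, so the
    quadratic term of the definition becomes a defect in the convexity inequality of [g] itself. *)
Lemma weakly_convexP lam (g : 'rV[R]_d -> R) : weakly_convex X lam g <->
  (forall t u v, 0 <= t <= 1 -> X u -> X v ->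
    g (t *: u + (1 - t) *: v) <=
    t * g u + (1 - t) * g v + lam / 2 * (t * (1 - t)) * dot (u - v) (u - v)).
Proof.
have E t u v : lam / 2 * (t * (1 - t)) * dot (u - v) (u - v) =
    t * (lam / 2 * enorm u ^+ 2) + (1 - t) * (lam / 2 * enorm v ^+ 2) -
    lam / 2 * enorm (t *: u + (1 - t) *: v) ^+ 2.
  by rewrite !enorm_sqr !dotE (dotC v u); field.
split=> [cg t u v /andP[t0 t1] Xu Xv|cg t u v Xu Xv].
  have /= := cg (Itv01 t0 t1) u v.
  rewrite !inE convRE => /(_ Xu Xv); rewrite E.
  by rewrite /unstable.onem /=; lra.
rewrite convRE; move: (cg t%:num u v); rewrite !inE in Xu Xv.
rewrite ge0 le1 => /(_ isT Xu Xv); rewrite E.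
by rewrite /unstable.onem /=; lra.
Qed.

(** The regularised function has convexity modulus c - lam. Comparing p with tu + (1-t)p, using this
    modulus and dividing by t gives the inequality with the factor 1 - t on its last term; then t
    tends to 0. *)
Lemma argmin_three_point lam c (g : 'rV[R]_d -> R) y p u :
  convex_set X -> weakly_convex X lam g ->
  is_argmin X (fun v => g v + c / 2 * enorm (v - y) ^+ 2) p -> X u ->
  g p + c / 2 * dot (p - y) (p - y) + (c - lam) / 2 * dot (u - p) (u - p) <=
  g u + c / 2 * dot (u - y) (u - y).
Proof.
move=> cX /weakly_convexP cg [Xp minp] Xu.
set a := g p + _; set b := g u + _; set e := (c - lam) / 2 * _.
have h t : 0 < t <= 1 -> a <= b - e * (1 - t).
  move=> /andP[t0 t1]; have t01 : 0 <= t <= 1 by rewrite ltW.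
  have := minp _ (convex_setE cX t01 Xu Xp); have := cg _ _ _ t01 Xu Xp.
  rewrite !enorm_sqr => c1 c2.
  rewrite -(ler_pM2l t0).
  have E : c / 2 * dot (t *: u + (1 - t) *: p - y) (t *: u + (1 - t) *: p - y) =
     t * (c / 2 * dot (u - y) (u - y)) + (1 - t) * (c / 2 * dot (p - y) (p - y))
     - t * (1 - t) * (c / 2 * dot (u - p) (u - p)).
    by rewrite !dotE (dotC p u) (dotC y u) (dotC y p); field.
  by move: c1 c2; rewrite E /a /b /e; lra.
rewrite leNgt; apply/negP => ltab.
pose s := a + e - b; have s0 : 0 < s by rewrite /s; lra.
have es1 : 0 < `|e| + s by rewrite ltr_wpDl.
(* One value of t replaces the limit: a positive excess s would give s <= e t by [h], whereas this
   choice makes |e| t < s / 2. *)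
pose t := s / (2 * (`|e| + s)).
have tE : t * (2 * (`|e| + s)) = s by rewrite /t divfK// gt_eqF// mulr_gt0.
have t0 : 0 < t by rewrite divr_gt0// mulr_gt0.
have ee : e <= `|e| by rewrite ler_norm.
have t1 : t <= 1.
  rewrite ler_pdivrMr ?mulr_gt0// mul1r; have := normr_ge0 e; lra.
have : a <= b - e * (1 - t) by apply: h; rewrite t0 t1.
have : e * t <= `|e| * t by rewrite ler_pM2r.
have : 0 < t * s by rewrite mulr_gt0.
rewrite /s in s0 tE *; nra.
Qed.
End euclidean.

(** * Proximal points and the Moreau envelope *)

Lemma minval_argmin (R : realType) (E : Type) (X : set E) (g : E -> R) x :
  is_argmin X g x -> minval X g = g x.
Proof.
move=> [Xx minx]; apply/eqP; rewrite eq_le; apply/andP; split.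
  apply: ge_inf; last by exists x.
  by exists (g x) => _ [y Xy <-]; exact: minx.
apply: lb_le_inf; first by exists (g x), x.
by move=> _ [y Xy <-]; exact: minx.
Qed.

(** Translates a growth bound in the Euclidean norm into a delta for the sup norm, which carries the
    topology. At sup distance at most 1 the quadratic term is dominated by a linear one, so the
    whole bound is at most [D] times the distance. The delta depends on a, b and e alone, which
    later gives equicontinuity uniform in the sample. *)
Lemma growth_small (R : realType) (d : nat) (a b e : R) :
  0 <= a -> 0 <= b -> 0 < e -> exists2 delta : R, 0 < delta &
  forall u v : 'rV[R]_d, `|u - v| < delta ->
    a * enorm (u - v) + b * enorm (u - v) ^+ 2 <= e.
Proof.
move=> a0 b0 e0; pose C := Num.sqrt d%:R : R.
have C0 : 0 <= C by exact: sqrtr_ge0.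
pose D := a * C + b * C ^+ 2 + 1.
have D0 : 0 < D by rewrite ltr_wpDl// addr_ge0// mulr_ge0// exprn_ge0.
exists (Num.min 1 (e / D)); first by rewrite lt_min ltr01 divr_gt0.
move=> u v; rewrite lt_min => /andP[y1 ye].
have rD : `|u - v| * D <= e by rewrite -ler_pdivlMr// ltW.
move: rD (ltW y1) (enorm_le_norm (u - v)) (normr_ge0 (u - v)) (enorm_ge0 (u - v)).
rewrite -/C; move: (enorm _) `|u - v| => m n rD n1 mCn n0 m0.
apply: le_trans rD; rewrite /D.
have : a * m <= a * (C * n) by rewrite ler_wpM2l.
have : b * m ^+ 2 <= b * (C * n) ^+ 2.
  by rewrite ler_wpM2l// ler_pXn2r ?nnegrE ?mulr_ge0.
have : b * C ^+ 2 * n ^+ 2 <= b * C ^+ 2 * n.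
  by rewrite ler_wpM2l// ?mulr_ge0 ?exprn_ge0// expr2 ler_piMr.
lra.
Qed.

Lemma growth_continuous (R : realType) (d : nat) (X : set 'rV[R]_d)
    (g : 'rV[R]_d -> R) (a b : R) : 0 <= a -> 0 <= b ->
  (forall u v, X u -> X v -> g u - g v <= a * enorm (u - v) + b * enorm (u - v) ^+ 2) ->
  {within X, continuous g}.
Proof.
move=> a0 b0 gr; apply/subspace_continuousP => x Xx.
apply/cvgrPdist_le => e e0; have [delta delta0 small] := growth_small d a0 b0 e0.
have ball : \forall y \near x, `|x - y| < delta.
  exact: (@cvgr_dist_lt _ _ _ (nbhs x) _ id x (@cvg_id _ _)).
rewrite near_withinE; apply: filterS ball => y /small H Xy.
have h1 := gr _ _ Xy Xx; rewrite (enormB y x) in h1.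
rewrite ler_norml; apply/andP; split; last exact: (le_trans (gr _ _ Xx Xy) H).
by rewrite lerNl opprB; exact: (le_trans h1 H).
Qed.

Lemma dist_sqr_continuous (R : realType) (d : nat) (c : R) (z : 'rV[R]_d) :
  continuous (fun y : 'rV[R]_d => c * enorm (z - y) ^+ 2).
Proof.
have coord i : continuous (fun y : 'rV[R]_d => z ord0 i - y ord0 i).
  move=> x; apply: continuousB; first exact: cst_continuous.
  exact: coord_continuous.
have -> : (fun y : 'rV[R]_d => c * enorm (z - y) ^+ 2) =
    (fun=> c) \* (fun y : 'rV[R]_d =>
      \sum_(i < d) (z ord0 i - y ord0 i) * (z ord0 i - y ord0 i)).
  apply/funext => y /=; rewrite enorm_sqr; congr (_ * _).
  by apply: eq_bigr => i _; rewrite !mxE.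
move=> x; apply: continuousM; first exact: cst_continuous.
pose t i (y : 'rV[R]_d) := (z ord0 i - y ord0 i) * (z ord0 i - y ord0 i).
have cs := @cvg_big R^o _ _ 0 xpredT (@add_continuous R) _ (nbhs x)
  (index_enum _) t (t ^~ x) (nbhs_filter x).
apply: cs => i _.
by apply: (@cvgM _ _ _ (nbhs_filter x)); exact: coord.
Qed.

Lemma compact_setI_ball (R : realType) (d : nat) (X : set 'rV[R]_d) z r :
  closed X -> compact (X `&` [set y | `|z - y| <= r]).
Proof.
move=> cX; apply: bounded_closed_compact.
  exists (`|z| + r); split; first exact: num_real.
  move=> M ltM y [_ /= zyr]; apply: le_trans (ltW ltM).
  have -> : y = z - (z - y) by rewrite opprB addrC subrK.
  by rewrite (le_trans (ler_normB _ _))// lerD2l.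
by apply: closedI => //; exact: closed_closed_ball_.
Qed.

Section prox.
Context {R : realType} {d : nat}.
Variables (X : set 'rV[R]_d) (g : 'rV[R]_d -> R) (mu rho a b : R).
Hypotheses (X0 : X !=set0) (cX : closed X) (convX : convex_set X).
Hypotheses (lb_g : has_lbound [set g u | u in X]) (wg : weakly_convex X mu g).
Hypotheses (a0 : 0 <= a) (b0 : 0 <= b) (rho0 : 0 < rho) (mu_rho : mu < rho).
Hypothesis growth_g : forall u v, X u -> X v ->
  g u - g v <= a * enorm (u - v) + b * enorm (u - v) ^+ 2.
Implicit Types z : 'rV[R]_d.

Let reg z y := g y + rho / 2 * enorm (z - y) ^+ 2.

(** A lower bound m of [g] makes the regularised function coercive: outside a large ball it exceeds
    its value at a feasible u0, and inside the ball compactness provides a minimiser. *)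
Lemma prox_exists z : exists p, is_argmin X (reg z) p.
Proof.
have [u0 Xu0] := X0; have [m lbm] := lb_g.
have mg y : X y -> m <= g y by move=> Xy; apply: lbm; exists y.
(* The 1 ensures |z - y| <= |z - y|^2 outside the ball, the second term puts u0 inside it, and the
   third makes the quadratic term there at least [reg z u0 - m]. *)
pose r := 1 + `|z - u0| + 2 / rho * (reg z u0 - m).
have r1 : 0 <= 2 / rho * (reg z u0 - m).
  apply: mulr_ge0; first by rewrite divr_ge0// ltW.
  rewrite /reg.
  have : 0 <= rho / 2 * enorm (z - u0) ^+ 2.
    by apply: mulr_ge0; [apply: divr_ge0; rewrite ?ltW|exact: sqr_ge0].
  by have := mg _ Xu0; lra.
pose A := X `&` [set y | `|z - y| <= r].
have A_comp : compact A by exact: compact_setI_ball.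
have A0 : A !=set0.
  by exists u0; split => //=; rewrite /r; have := normr_ge0 (z - u0); lra.
have reg_cont : {within A, continuous (reg z)}.
  apply: (@continuous_subspaceW _ _ _ X); first by move=> y [].
  move=> x; apply: cvgD; first exact: (growth_continuous a0 b0 growth_g).
  exact: (continuous_subspaceT (@dist_sqr_continuous _ _ _ z)).
have [p] := compact_EVT_min A0 A_comp reg_cont.
rewrite inE => -[Xp _] minp; exists p; split => // y Xy.
have [yr|ry] := leP `|z - y| r; first by apply: minp; rewrite inE.
apply: (@le_trans _ _ (reg z u0)).
  apply: minp; rewrite inE; split => //=; rewrite /r.
  by have := normr_ge0 (z - u0); lra.
have zy1 : 1 <= `|z - y|.
  by apply: le_trans (ltW ry); rewrite /r; have := normr_ge0 (z - u0); lra.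
have le1 : `|z - y| <= enorm (z - y) ^+ 2.
  have := norm_le_enorm (z - y); nra.
have : rho / 2 * r <= rho / 2 * enorm (z - y) ^+ 2.
  by rewrite ler_pM2l ?divr_gt0// (le_trans (ltW ry)).
have : rho / 2 * (2 / rho * (reg z u0 - m)) = reg z u0 - m.
  by field; rewrite gt_eqF.
have : rho / 2 * (2 / rho * (reg z u0 - m)) <= rho / 2 * r.
  by rewrite ler_pM2l ?divr_gt0// /r; have := normr_ge0 (z - u0); lra.
by have := mg _ Xy; rewrite /reg; lra.
Qed.

(** The default 0 is never taken, since a minimiser exists. *)
Definition prox z : 'rV[R]_d := xget 0 [set p | is_argmin X (reg z) p].

Lemma proxP z : is_argmin X (reg z) (prox z).
Proof. exact: (xgetPex 0 (prox_exists z)). Qed.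

Lemma prox_in z : X (prox z). Proof. by case: (proxP z). Qed.

Lemma moreauE z :
  moreau X g rho z = g (prox z) + rho / 2 * dot (z - prox z) (z - prox z).
Proof. by rewrite /moreau (minval_argmin (proxP z)) /reg enorm_sqr. Qed.

Lemma moreau_le z u : X u ->
  moreau X g rho z <= g u + rho / 2 * dot (z - u) (z - u).
Proof.
by rewrite -enorm_sqr /moreau (minval_argmin (proxP z)); case: (proxP z) => _; apply.
Qed.

Lemma prox_three_point z u : X u ->
  g (prox z) + rho / 2 * dot (prox z - z) (prox z - z) +
    (rho - mu) / 2 * dot (u - prox z) (u - prox z) <=
  g u + rho / 2 * dot (u - z) (u - z).
Proof.
apply: argmin_three_point => //.
have [Xp minp] := proxP z; split => // v Xv.
by rewrite !(enormB _ z); exact: minp.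
Qed.

Let q := rho / (rho - mu).

Let q0 : 0 < q. Proof. by rewrite divr_gt0// subr_gt0. Qed.

(** Adding the three-point inequalities at z and z', each tested at the other proximal point p' or
    p, cancels the values of [g] and leaves (rho - mu)|p - p'|^2 <= rho <z - z', p - p'>. Young's
    inequality then gives the constant q = rho / (rho - mu). *)
Lemma prox_lipschitz_sqr z z' :
  dot (prox z - prox z') (prox z - prox z') <= q ^+ 2 * dot (z - z') (z - z').
Proof.
have c0 : 0 < rho - mu by rewrite subr_gt0.
have qE : q * (rho - mu) = rho by rewrite divfK// gt_eqF.
have := prox_three_point z (prox_in z'); have := prox_three_point z' (prox_in z).
move: qE (prox z) (prox z'); move: q => r rE p p' h1 h2.
have h : dot (p - p') (p - p') <= r * dot (z - z') (p - p').
  rewrite -(ler_pM2l c0) mulrA (mulrC _ r) rE; move: h1 h2 {rE c0}.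
  rewrite !dotE (dotC p' p) (dotC p z) (dotC p z') (dotC p' z) (dotC p' z').
  move: (g p) (g p') (dot p p) (dot p' p') (dot z p) (dot z p') (dot z' p)
    (dot z' p') (dot p p') (dot z z) (dot z' z').
  by move=> *; lra.
have := dot_young (r *: (z - z')) (p - p'); move: h => {h1 h2}.
rewrite dotZl (dotZl _ _ (r *: _)) dotZr => h young.
lra.
Qed.

Lemma prox_lipschitz z z' : enorm (prox z - prox z') <= q * enorm (z - z').
Proof.
have qe0 : 0 <= q * enorm (z - z') by rewrite mulr_ge0 ?enorm_ge0// ltW.
rewrite -(@ler_pXn2r _ 2%N) ?nnegrE ?enorm_ge0//.
by rewrite exprMn !enorm_sqr prox_lipschitz_sqr.
Qed.

Lemma prox_norm_le z : `|prox z| <= `|prox 0| + q * (Num.sqrt d%:R * `|z|).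
Proof.
have -> : prox z = prox 0 + (prox z - prox 0) by rewrite addrC subrK.
rewrite (le_trans (ler_normD _ _))// lerD2l.
apply: le_trans (norm_le_enorm _) _; apply: le_trans (prox_lipschitz z 0) _.
by rewrite subr0 ler_pM2l// enorm_le_norm.
Qed.

(** Needed for the measurability of the proximal points along the random path. *)
Lemma prox_coord_continuous i : continuous (fun z => prox z ord0 i).
Proof.
suff : {within setT, continuous (fun z => prox z ord0 i)}.
  exact: (continuous_subspace_setT _).2.
apply: (growth_continuous (ltW q0) (lexx 0)) => z z' _ _.
rewrite mul0r addr0 (le_trans _ (prox_lipschitz z z'))//.
apply: le_trans (coord_le_enorm _ i); rewrite !mxE.
exact: ler_norm.
Qed.

(** A sandwich argument: testing the envelope at z + hv with the proximal point of z, and the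
    envelope at z with the proximal point of z + hv, encloses the increment. The two bounds differ
    from h rho <z - p, v> by O(h^2), because the proximal map is Lipschitz. *)
Lemma moreau_derive z v :
  'D_v (moreau X g rho) z = rho * dot (z - prox z) v.
Proof.
apply/cvg_lim => //; apply/cvgrPdist_le => e e0.
pose C := rho / 2 * ((q ^+ 2 + 2) * dot v v) + 1.
have C0 : 0 < C.
  rewrite /C ltr_wpDl//; apply: mulr_ge0; first by rewrite divr_ge0// ltW.
  by rewrite mulr_ge0 ?dot_ge0// addr_ge0// sqr_ge0.
near=> h.
have h0 : h != 0 by near: h; exact: nbhs_dnbhs_neq.
have hC : `|h| * C <= e.
  rewrite -ler_pdivlMr//; near: h; apply: dnbhs0_le; exact: divr_gt0.
apply: le_trans hC.
have hh0 : 0 < `|h| by rewrite normr_gt0.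
(* Multiplication by |h| clears the difference quotient, so the error to bound is h^2 [C]. *)
rewrite /= -(ler_pM2l hh0) -normrM mulrBr /GRing.scale/= mulVKf//.
have -> : `|h| * (`|h| * C) = h ^+ 2 * C.
  by rewrite mulrA -expr2 real_normK ?num_real.
have up := moreau_le (h *: v + z) (prox_in z).
have lo := moreau_le z (prox_in (h *: v + z)).
have := prox_lipschitz_sqr z (h *: v + z).
have := dot_young (prox z - prox (h *: v + z)) (h *: v).
have := dot_young (prox (h *: v + z) - prox z) (h *: v).
have := dot_ge0 v.
rewrite /C; move: up lo; rewrite !moreauE; move: (prox z) (prox (h *: v + z)) => p p'.
rewrite !dotE (dotC v z) (dotC p z) (dotC p' z) (dotC p' p) (dotC v p) (dotC v p').
move: (g p) (g p') (dot z z) (dot p p) (dot p' p') (dot z p) (dot z p')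
  (dot p p') (dot v v) (dot z v) (dot p v) (dot p' v).
move=> gp gp' zz pp p'p' zp zp' pp' vv zv pv p'v up lo vv0 y1 y2 lip.
have hv0 : 0 <= rho * (h ^+ 2 * vv).
  by apply: mulr_ge0; [exact: ltW|rewrite mulr_ge0// sqr_ge0].
have h20 : 0 <= h ^+ 2 by exact: sqr_ge0.
have l1 : rho * (2 * (h * p'v - h * pv)) <= rho * ((q ^+ 2 + 1) * (h ^+ 2 * vv)).
  by rewrite ler_pM2l//; lra.
have l2 : rho * (2 * (h * pv - h * p'v)) <= rho * ((q ^+ 2 + 1) * (h ^+ 2 * vv)).
  by rewrite ler_pM2l//; lra.
have q2 : 0 <= q ^+ 2 * (rho * (h ^+ 2 * vv)) by rewrite mulr_ge0// sqr_ge0.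
by rewrite ler_norml; apply/andP; split; lra.
Unshelve. all: by end_near.
Qed.

Lemma gradient_moreau z : gradient (moreau X g rho) z = rho *: (z - prox z).
Proof.
apply/rowP => i; rewrite !mxE moreau_derive; congr (_ * _).
rewrite /dot (bigD1 i)//= !mxE !eqxx mulr1 big1 ?addr0// => j ji.
by rewrite !mxE (negPf ji) andbF mulr0.
Qed.
End prox.

(** * Measurability of random vectors *)

Section measurable_vectors.
Context {R : realType} {d : nat} {dO : measure_display} {O : measurableType dO}.
Variable Y : O -> 'rV[R]_d.
Hypothesis mY : forall i, measurable_fun setT (fun w => Y w ord0 i).

(** An open set is the countable union of the cubes with rational centre and half-side 1/(n+1) that
    it contains, and the preimage of a cube is a finite intersection of coordinate preimages. *)
Lemma measurable_preimage_open (U : set 'rV[R]_d) :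
  open U -> measurable (Y @^-1` U).
Proof.
move=> oU.
pose B (qn : 'rV[rat]_d * nat) : set 'rV[R]_d :=
  [set y | forall i, `|y ord0 i - ratr (qn.1 ord0 i)| < qn.2.+1%:R^-1].
have mB qn : measurable (Y @^-1` B qn).
  rewrite (_ : Y @^-1` B qn = \bigcap_(i in setT)
      (fun w => Y w ord0 i) @^-1` (ball (ratr (qn.1 ord0 i) : R) qn.2.+1%:R^-1)).
    apply: fin_bigcap_measurable; first exact: finite_finset.
    move=> i _; rewrite -[X in measurable X]setTI.
    apply: mY => //; apply: open_measurable; exact: ball_open.
  apply/seteqP; split => w /= h i; first by move=> _; rewrite /= /ball/= distrC.
  by have := h i Logic.I; rewrite /= /ball/= distrC.
rewrite (_ : Y @^-1` U = \bigcup_qn (if `[< B qn `<=` U >] then Y @^-1` B qn else set0)).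
  apply: countable_bigcupT_measurable; first exact: countableP.
  by move=> qn; case: ifP.
apply/seteqP; split => [w /= Uw|w [qn _]]; last first.
  by case: ifP => // /asboolP BU /BU.
have /nbhs_ballP[e /= e0 eU] : nbhs (Y w) U by exact: open_nbhs_nbhs.
(* A cube that contains Y w has all its points within 2/(n+1) < e of Y w, hence lies in U. *)
have [n ne] : exists n : nat, n.+1%:R^-1 < e / 2 :> R.
  have e20 : 0 < e / 2 by rewrite divr_gt0.
  have [n _ /(_ n (leqnn n))] := near_infty_natSinv_lt (PosNum e20).
  by exists n.
have n0 : 0 < n.+1%:R^-1 :> R by rewrite invr_gt0.
have /choice[q qP] : forall i, exists q : rat, `|Y w ord0 i - ratr q| < n.+1%:R^-1.
  move=> i; have [|q] := @rat_in_itvoo R (Y w ord0 i) (Y w ord0 i + n.+1%:R^-1).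
    by rewrite ltrDl.
  rewrite in_itv/= => /andP[q1 q2]; exists q.
  rewrite ltr_norml; move: q1 q2 n0; move: (n.+1%:R^-1) => t q1 q2 t0.
  by apply/andP; split; lra.
exists (\row_i q i, n) => //; case: ifPn => [_|/asboolPn[]].
  by move=> i /=; rewrite mxE.
move=> y yB; apply: eU; split => // i j; rewrite (ord1 i) /ball/=.
have := yB j; have := qP j; rewrite /= mxE => h1 h2.
rewrite (_ : _ - _ = (Y w ord0 j - ratr (q j)) - (y ord0 j - ratr (q j))); last by ring.
rewrite (le_lt_trans (ler_normB _ _))//; move: h1 h2 ne.
by move: (n.+1%:R^-1) => t h1 h2 ne; lra.
Qed.

Lemma measurable_fun_continuous_comp (g : 'rV[R]_d -> R) :
  continuous g -> measurable_fun setT (g \o Y).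
Proof.
move=> cg; apply: (measurability _ (RGenOInfty.measurableE R)).
move=> _ [_ [x ->] <-]; rewrite setTI comp_preimage.
apply: measurable_preimage_open.
by move/continuousP : cg; apply; exact: interval_open.
Qed.

End measurable_vectors.

(** * Independence *)

Section independence_integral.
Context {R : realType} {dO : measure_display} {O : measurableType dO}.
Context {dT : measure_display} {T : measurableType dT}.
Variables (P : probability O R) (Xi : probability T R) (xi : O -> T) (A : set O).
Hypotheses (mxi : measurable_fun setT xi) (mA : measurable A).
Hypothesis xiA : forall B, measurable B ->
  P (A `&` xi @^-1` B) = (P A * Xi B)%E.

Local Open Scope ereal_scope.

(** Independence says that the restriction of P to A, pushed forward by [xi], is the measure P(A)
    Xi; the claim is a change of variables. *)
Lemma ge0_integral_indep (h : T -> \bar R) :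
  measurable_fun setT h -> (forall t, 0 <= h t) ->
  \int[P]_(w in A) h (xi w) = P A * \int[Xi]_t h t.
Proof.
move=> mh h0.
have mhxi : measurable_fun setT (h \o xi) by exact: measurableT_comp.
have PA0 : (0 <= fine (P A))%R by rewrite fine_ge0.
pose nu : {measure set O -> \bar R} := mrestr P mA.
transitivity (\int[nu]_(w in A) h (xi w)).
  apply: eq_measure_integral => B mB BA.
  by rewrite /nu/= /mrestr setIidl.
(* The restricted measure does not charge the complement of A, so the domain may be enlarged to the
   whole space. *)
transitivity (\int[nu]_w h (xi w)).
  rewrite [RHS](@ge0_negligible_integral _ _ _ nu _ (~` A))//.
  - by rewrite setTD setCK.
  - exact: measurableC.
  - by rewrite /nu/= /mrestr setICl measure0.
transitivity (\int[pushforward nu xi]_t h t).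
  by rewrite ge0_integral_pushforward.
transitivity (\int[mscale (NngNum PA0) Xi]_t h t).
  apply: eq_measure_integral => B mB _.
  by rewrite /nu/= /pushforward /mrestr /mscale/= setIC xiA// fineK// fin_num_measure.
by rewrite ge0_integral_mscale//= fineK// fin_num_measure.
Qed.

Lemma integrable_indep (h : T -> \bar R) :
  Xi.-integrable setT h -> P.-integrable A (h \o xi).
Proof.
move=> /integrableP[mh hoo]; apply/integrableP; split.
  by apply: measurable_funTS; exact: measurableT_comp.
rewrite (ge0_integral_indep (h := abse \o h)) //=; last exact: measurableT_comp.
rewrite -(fineK (fin_num_measure P _ mA)) lte_mul_pinfty//.
by rewrite lee_fin fine_ge0.
Qed.

Lemma integral_indep (h : T -> \bar R) :
  Xi.-integrable setT h ->
  \int[P]_(w in A) h (xi w) = P A * \int[Xi]_t h t.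
Proof.
move=> /[dup] ih /integrableP[mh _].
have def : \int[Xi]_t h^\+ t +? - \int[Xi]_t h^\- t.
  apply: fin_num_adde_defr; apply: integrable_fin_num => //.
  exact: integrable_funepos.
rewrite integralE [X in _ = _ * X]integralE [RHS]muleBr ?fin_num_measure//.
rewrite -[(fun w => h (xi w))]/(h \o xi) funepos_comp funeneg_comp.
by congr (_ - _); apply: ge0_integral_indep => //;
  [exact: measurable_funepos|exact: measurable_funeneg].
Qed.

End independence_integral.

(** A pi-lambda argument. Finite intersections of events of the first k samples form a pi-system
    generating the history. On it the product formula is mutual independence of k + 1 samples, and
    the events satisfying the formula are closed under complements and countable disjoint unions. *)
Lemma history_independent (R : realType) (dO dT : measure_display)
    (O : measurableType dO) (T : measurableType dT) (P : probability O R)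
    (xi : nat -> O -> T) (K k : nat) (A B : set O) :
  (forall j, measurable_fun setT (xi j)) ->
  mutually_independent P [set k | (1 <= k <= K)%N]
    (fun k => g_sigma_algebra_preimage (xi k)) ->
  (k < K)%N -> history xi k A -> g_sigma_algebra_preimage (xi k.+1) B ->
  P (A `&` B) = (P A * P B)%E.
Proof.
move=> mxi ind kK hA hB.
have mpre j C : g_sigma_algebra_preimage (xi j) C -> measurable C.
  by move=> [D mD <-]; exact: mxi.
pose J : {fset nat} := [fset j in iota 1 k]%fset.
have inJ j : (j \in J) = (1 <= j <= k)%N.
  by rewrite inE /= mem_iota add1n ltnS.
clearbody J.
pose G : set_system O := [set S | exists2 C : nat -> set O,
  (forall j, j \in J -> g_sigma_algebra_preimage (xi j) (C j)) &
  S = \bigcap_(j in [set` J]) C j].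
have mG S : G S -> measurable S.
  move=> [C CP ->]; apply: fin_bigcap_measurable => [|j /= jJ]; first exact: finite_fset.
  exact/mpre/CP.
have hG : history xi k `<=` <<s G >>.
  apply: smallest_sub; first exact: smallest_sigma_algebra.
  move=> S [j /= jk jS]; apply: sub_gen_smallest.
  (* A single generator is an intersection over all of [J] whose other factors are the whole
     space. *)
  exists (fun i => if i == j then S else setT) => [i iJ|].
    case: eqP => [->//|_]; exists setT => //.
    by rewrite preimage_setT setTI.
  apply/seteqP; split => w /=.
    by move=> Sw i /= _; case: eqP.
  by move=> /(_ j); rewrite /= inJ eqxx; apply.
have mB : measurable B := mpre _ _ hB.
have sG : <<s G >> `<=` @measurable _ O.
  by apply: smallest_sub; [exact: sigma_algebra_measurable|exact: mG].
pose Q (S : set O) := P (S `&` B) = (P S * P B)%E.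
have QC S : measurable S -> Q S -> Q (~` S).
  move=> mS QS; rewrite /Q setIC -setDE measureD//; last first.
    by rewrite ltey_eq fin_num_measure.
  rewrite (setIC B S) probability_setC// muleBl ?fin_num_measure// mul1e.
  by congr (_ - _)%E; exact: QS.
have QU (F : (set O)^nat) : (forall n, measurable (F n)) -> trivIset setT F ->
    (forall n, Q (F n)) -> Q (\bigcup_n F n).
  move=> mF tF FB; rewrite /Q setI_bigcupl measure_bigcup//; last 2 first.
  - by move=> n _; exact: measurableI.
  - exact: trivIset_setIr.
  rewrite measure_bigcup// -(fineK (fin_num_measure P _ mB)).
  rewrite muleC -nneseriesZl//; apply: eq_eseriesr => n _.
  by rewrite fineK ?fin_num_measure// muleC; exact: FB.
apply: (@dynkin_induction _ (g_sigma_algebraType G) G Q) => //; last exact: hG.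
- move=> S S' [C CP ->] [C' CP' ->]; exists (fun j => C j `&` C' j) => [j jJ|].
    have [D mD <-] := CP j jJ; have [D' mD' <-] := CP' j jJ.
    exists (D `&` D'); first exact: measurableI.
    by rewrite !setTI preimage_setI.
  by rewrite bigcapI.
- by rewrite /Q setTI probability_setT mul1e.
- move=> _ [C CP ->]; rewrite /Q; have kJ : k.+1 \notin J by rewrite inJ ltnn andbF.
  have JP j : j \in J -> (1 <= j <= K)%N.
    by rewrite inJ => /andP[-> /leq_trans->//]; exact: ltnW.
  rewrite (ind J C)//; last by move=> j jJ; split; [exact: JP|exact: CP].
  (* B becomes the factor of index k + 1, so that mutual independence applies to the enlarged index
     set. *)
  pose C' j := if j == k.+1 then B else C j.
  have C'J j : j \in J -> C' j = C j.
    by move=> jJ; rewrite /C'; case: eqP => // jk; rewrite -jk jJ in kJ.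
  have := ind (k.+1 |` J)%fset C'; rewrite big_fsetU1// /C' eqxx => E.
  transitivity (P (\bigcap_(i in [set` (k.+1 |` J)%fset]) C' i)).
    congr (P _); apply/seteqP; split => w /=.
      move=> [CJ Bw] i /=; rewrite !inE => /orP[/eqP->|iJ].
        by rewrite /C' eqxx.
      by rewrite C'J//; exact: CJ.
    move=> CJ; split.
      by move=> i /= iJ; rewrite -C'J//; apply: CJ; rewrite /= !inE iJ orbT.
    by have := CJ k.+1; rewrite /C' eqxx; apply; rewrite /= !inE eqxx.
  rewrite E; last first.
    move=> i; rewrite !inE => /orP[/eqP->|iJ]; first by rewrite eqxx.
    by rewrite -/(C' i) C'J//; split; [exact: JP|exact: CP].
  rewrite muleC; congr (_ * _)%E; rewrite !big_seq; apply: eq_bigr => i iJ.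
  by rewrite -/(C' i) C'J.
- by move=> S mS; apply: QC; exact: sG.
- move=> F mF; apply: QU => n; exact: sG _ (mF n).
Qed.

(** * Freezing an independent argument *)

Lemma compact_finite_net (R : realType) (d : nat) (K : set 'rV[R]_d) (r : R) :
  compact K -> 0 < r ->
  exists2 s : seq 'rV[R]_d, (forall p, p \in s -> K p) &
    forall y, K y -> exists2 p, p \in s & `|y - p| < r.
Proof.
rewrite compact_cover => cK r0.
have [|y Ky|D DK cov] := cK _ K (fun p => ball p r).
- by move=> p _; exact: ball_open.
- by exists y => //; exact: ballxx.
exists D => [p /DK|y /cov[p /= pD]]; first by rewrite inE.
by rewrite -ball_normE /= distrC => yp; exists p.
Qed.

Section frozen_argument.
Context {R : realType} {d : nat} {dO : measure_display} {O : measurableType dO}.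
Context {dT : measure_display} {T : measurableType dT}.
Variables (P : probability O R) (Xi : probability T R) (xi : O -> T).
Variables (X : set 'rV[R]_d) (h : 'rV[R]_d -> T -> R).
Variables (U : set_system O) (Y : O -> 'rV[R]_d) (r : R).
Hypotheses (mxi : measurable_fun setT xi) (sU : <<s U>> `<=` measurable).
Hypothesis indep : forall A B, <<s U>> A -> measurable B ->
  P (A `&` xi @^-1` B) = (P A * Xi B)%E.
Hypothesis closedX : closed X.
Hypothesis h_integrable : forall u, X u -> Xi.-integrable setT (EFin \o h u).
Hypothesis h_centered : forall u, X u -> (\int[Xi]_s (h u s)%:E = 0)%E.
Hypothesis h_equicontinuous : forall e : R, 0 < e -> exists2 delta : R, 0 < delta &
  forall u v, X u -> X v -> `|u - v| < delta -> forall s, `|h u s - h v s| <= e.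
Hypothesis mY : forall i,
  measurable_fun setT (fun w : g_sigma_algebraType U => Y w ord0 i).
Hypotheses (YX : forall w, X (Y w)) (Y_bounded : forall w, `|Y w| <= r).

Let near_measurable p (delta : R) : <<s U>> [set w | `|Y w - p| < delta].
Proof.
have [d0|d0] := ltP 0 delta; last first.
  rewrite [X in <<s U>> X](_ : _ = set0); first exact: (@measurable0 _ (g_sigma_algebraType U)).
  by apply/seteqP; split => w //=; rewrite ltNge (le_trans d0).
have ob : open (ball p delta) by exact: ball_open.
have := measurable_preimage_open mY ob.
by rewrite -ball_normE; under [X in <<s U>> X]eq_set do rewrite distrC.
Qed.

(** Y is replaced by the first point p of the net [s] within delta of it. On each resulting cell the
    approximant is h p (xi). The cell belongs to the sigma-algebra independent of [xi], so the
    integral over it is P(cell) times the mean of h p, which is 0. The induction peels off one net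
    point at a time. *)
Let simple_approx (e delta : R) (s : seq 'rV[R]_d) (D : set O) : 0 < e ->
  (forall u v, X u -> X v -> `|u - v| < delta -> forall s, `|h u s - h v s| <= e) ->
  (forall p, p \in s -> X p) -> <<s U>> D ->
  (forall w, D w -> exists2 p, p \in s & `|Y w - p| < delta) ->
  exists N : O -> R, [/\ P.-integrable setT (EFin \o N),
    (\int[P]_w (N w)%:E = 0)%E,
    forall w, D w -> `|h (Y w) (xi w) - N w| <= e &
    forall w, ~ D w -> N w = 0].
Proof.
move=> e0 hdelta; elim: s D => [|p s IH] D sX mD cov.
  exists (cst 0); split => //; first exact: finite_measure_integrable_cst.
    by rewrite integral0_eq.
  by move=> w /cov[].
pose A := [set w | `|Y w - p| < delta].
have mA : <<s U>> A by exact: near_measurable.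
have mDA : <<s U>> (D `&` A) by exact: (@measurableI _ (g_sigma_algebraType U)).
have mDNA : <<s U>> (D `\` A) by exact: (@measurableD _ (g_sigma_algebraType U)).
have Xp : X p by apply: sX; rewrite inE eqxx.
(* The remaining points only have to cover the part of D outside A. The approximant obtained there
   vanishes on A, so the two pieces do not overlap. *)
have [q qs||w [Dw /= nAw]|N [iN N0 Ne Nz]] := IH (D `\` A).
- by apply: sX; rewrite inE qs orbT.
- exact: mDNA.
- by have [q] := cov w Dw; rewrite inE => /orP[/eqP->|qs] // wq; exists q.
have mDA' := sU mDA.
have iM := integrable_indep mxi mDA' (fun B => @indep _ B mDA) (h_integrable Xp).
have M0 : (\int[P]_(w in D `&` A) (h p (xi w))%:E = 0)%E.
  rewrite (integral_indep mxi mDA' (fun B => @indep _ B mDA) (h_integrable Xp)).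
  by rewrite h_centered// mule0.
pose M := (h p \o xi) \_ (D `&` A).
have ME : (EFin \o (h p \o xi)) \_ (D `&` A) = EFin \o M by rewrite restrict_EFin.
have iM' : P.-integrable setT (EFin \o M).
  by rewrite -ME; exact: (iffLR (integrable_mkcond _ mDA') iM).
exists (fun w => M w + N w); split.
- by rewrite [X in _.-integrable _ X](_ : _ = (EFin \o M) \+ (EFin \o N))%E//; exact: integrableD.
- under eq_integral do rewrite EFinD.
  rewrite integralD//= N0 adde0 -M0 [RHS]integral_mkcond.
  by apply: eq_integral => w _; rewrite -[LHS]/((EFin \o M) w) -ME.
- move=> w Dw; rewrite /M patchE; case: ifPn => [|nDA].
    rewrite inE => -[_ Aw]; rewrite Nz ?addr0; last by case.
    exact: hdelta.
  rewrite add0r; apply: Ne; split => // Aw.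
  by move: nDA; rewrite notin_setE; apply.
- move=> w nD; rewrite /M patchE memNset; last by case.
  by rewrite add0r Nz//; case.
Qed.

(** Centred approximants with uniform error e exist for every e > 0. Their limit is therefore
    measurable, and its integral lies between -e and e for every e. *)
Lemma frozen_centered :
  P.-integrable setT (EFin \o (fun w => h (Y w) (xi w))) /\
  (\int[P]_w (h (Y w) (xi w))%:E = 0)%E.
Proof.
pose H w := h (Y w) (xi w); rewrite -[fun w => h _ _]/H.
have approx (e : R) : 0 < e -> exists N : O -> R, [/\ P.-integrable setT (EFin \o N),
    (\int[P]_w (N w)%:E = 0)%E & forall w, `|H w - N w| <= e].
  move=> e0; have [delta delta0 hdelta] := h_equicontinuous e0.
  have cK := @compact_setI_ball _ _ X 0 r closedX.
  have [s sK net] := compact_finite_net cK delta0.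
  have [||w _|N [iN N0 Ne _]] := simple_approx (D := setT) e0 hdelta (s := s).
  - by move=> p /sK[].
  - exact: (@measurableT _ (g_sigma_algebraType U)).
  - by apply: net; split => //=; rewrite sub0r normrN.
  - by exists N; split => // w; exact: Ne.
have inv0 n : 0 < n.+1%:R^-1 :> R by rewrite invr_gt0.
have /choice[N NP] := fun n => approx _ (inv0 n).
have mH : measurable_fun setT H.
  apply: (measurable_fun_cvg (h := N)) => [n|w _].
    by case: (NP n) => /measurable_int/measurable_EFinP.
  apply/cvgrPdist_le => e e0; near=> n.
  have [_ _ /(_ w) /le_trans] := NP n; apply.
  by apply: ltW; near: n; exact: (near_infty_natSinv_lt (PosNum e0)).
have iH : P.-integrable setT (EFin \o H).
  (* The approximant of index 0 has error at most 1, so its absolute value plus 1 dominates [H]. *)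
  have [iN _ Ne] := NP 0%N.
  pose G0 w := `|N 0%N w|; pose G w := G0 w + 1.
  apply: (le_integrable _ _ (g := EFin \o G)) => //.
  - exact/measurable_EFinP.
  - move=> w _ /=; have G00 : 0 <= G0 w by exact: normr_ge0.
    rewrite lee_fin [leRHS]ger0_norm ?addr_ge0//.
    have := Ne w; rewrite invr1 => H1.
    have -> : H w = N 0%N w + (H w - N 0%N w) by rewrite addrC subrK.
    by rewrite (le_trans (ler_normD _ _))// lerD2l.
  - rewrite [X in _.-integrable _ X](_ : _ = (EFin \o G0) \+ cst 1%:E)%E//.
    apply: integrableD => //; last exact: finite_measure_integrable_cst.
    exact: integrable_norm.
split => //; apply/eqP; rewrite eq_le.
have cst_int (c : R) : (\int[P]_w (cst c%:E w) = c%:E)%E.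
  by rewrite integral_cst//= probability_setT mule1.
apply/andP; split.
  apply/lee_addgt0Pr => e e0; have [M [iM M0 Me]] := approx _ e0.
  rewrite add0e -[leRHS](cst_int e) -[leRHS]add0e -M0 -integralD//; last first.
    exact: finite_measure_integrable_cst.
  apply: le_integral => //.
    by apply: integrableD => //; exact: finite_measure_integrable_cst.
  by move=> w _ /=; rewrite lee_fin; have := Me w; rewrite /H ler_norml => /andP[]; lra.
apply/lee_addgt0Pr => e e0; have [M [iM M0 Me]] := approx _ e0.
rewrite -[e%:E](cst_int e) -integralD//; last exact: finite_measure_integrable_cst.
rewrite -M0; apply: le_integral => //.
  by apply: integrableD => //; exact: finite_measure_integrable_cst.
by move=> w _ /=; rewrite lee_fin; have := Me w; rewrite /H ler_norml => /andP[]; lra.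
Unshelve. all: by end_near. Qed.

End frozen_argument.

(** * The inequality along a sample path *)

Section path.
Context {R : realType} {d : nat} {T : Type}.
Variables (X : set 'rV[R]_d) (F : 'rV[R]_d -> T -> R) (f : 'rV[R]_d -> R).
Variable model : 'rV[R]_d -> T -> 'rV[R]_d -> R.
Variables (lambda tau L mu rho beta theta gamma kappa v : R).
Hypotheses (X0 : X !=set0) (cX : closed X) (convX : convex_set X).
Hypothesis f_lb : has_lbound [set f u | u in X].
Hypothesis f_wc : weakly_convex X mu f.
Hypothesis f_growth : forall u u', X u -> X u' ->
  f u - f u' <= L * enorm (u - u') + tau / 2 * enorm (u - u') ^+ 2.
Hypotheses (lambda_ge0 : 0 <= lambda) (tau_ge0 : 0 <= tau) (L_gt0 : 0 < L).
Hypothesis mu_lt : mu < lambda + tau.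
Hypothesis model_wc : forall u s, X u -> weakly_convex X lambda (model u s).
Hypothesis model_exact : forall u s, X u -> model u s u = F u s.
Hypothesis model_upper : forall u u' s, X u -> X u' ->
  model u s u' - F u' s <= tau / 2 * enorm (u - u') ^+ 2.
Hypothesis model_lipschitz : forall u u1 u2 s, X u -> X u1 -> X u2 ->
  model u s u2 - model u s u1 <= L * enorm (u2 - u1).
Hypotheses (rho_gt0 : 0 < rho) (rho_ge : 2 * (tau + lambda) <= rho).
Hypotheses (beta_ge0 : 0 <= beta) (beta_lt1 : beta < 1).
Hypothesis theta_def : theta = 1 - beta.
Hypothesis kappa_gt0 : 0 < kappa.
Hypothesis vE : v * theta ^+ 2 = rho * beta ^+ 2.
Hypothesis gammaE : gamma * theta = kappa + lambda * theta + v.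

Let theta_gt0 : 0 < theta. Proof. by rewrite theta_def subr_gt0. Qed.

Let mu_rho : mu < rho. Proof. by move: mu_lt rho_ge rho_gt0; lra. Qed.

Let v_ge0 : 0 <= v.
Proof.
have t2 : 0 < theta ^+ 2 by rewrite exprn_gt0.
by rewrite -(pmulr_lge0 _ t2) vE mulr_ge0 ?sqr_ge0// ltW.
Qed.

Let gamma_gt : lambda < gamma.
Proof. by rewrite -(ltr_pM2r theta_gt0) gammaE; move: kappa_gt0 v_ge0; lra. Qed.

(** Here [kappa] stands for gamma0 sqrt K and [v] for rho beta^2 / theta^2. For theta >= 1/2 the
    term lambda theta already covers lambda / 2. Otherwise beta >= theta, so v >= rho >= 2 lambda
    covers it. *)
Let theta_gamma : kappa <= gamma * theta - lambda / 2.
Proof.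
rewrite gammaE; have [t2|t2] := leP (1 / 2) theta.
  have : lambda * (1 / 2) <= lambda * theta by rewrite ler_wpM2l.
  by move: v_ge0; lra.
have : rho * theta ^+ 2 <= v * theta ^+ 2.
  have t0 : 0 <= theta by exact: ltW.
  rewrite vE ler_pM2l// ler_pXn2r ?nnegrE//.
  by move: t2; rewrite theta_def; lra.
rewrite ler_pM2r ?exprn_gt0// => rv.
have : 0 <= lambda * theta by rewrite mulr_ge0// ltW.
by move: lambda_ge0 tau_ge0 rho_ge; lra.
Qed.

Let tau2_ge0 : 0 <= tau / 2. Proof. by rewrite divr_ge0. Qed.

Let prox_X z : X (prox X f rho z).
Proof. exact: (prox_in X0 cX f_lb (ltW L_gt0) tau2_ge0 rho_gt0 f_growth). Qed.

Let moreau_prox z : moreau X f rho z = f (prox X f rho z) +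
  rho / 2 * dot (z - prox X f rho z) (z - prox X f rho z).
Proof. exact: (moreauE X0 cX f_lb (ltW L_gt0) tau2_ge0 rho_gt0 f_growth). Qed.

Let moreau_min z u : X u ->
  moreau X f rho z <= f u + rho / 2 * dot (z - u) (z - u).
Proof. exact: (moreau_le X0 cX f_lb (ltW L_gt0) tau2_ge0 rho_gt0 f_growth). Qed.

(** * A single iteration *)

Section step.
Variables (s : T) (m x x' : 'rV[R]_d).
Let y := x + beta *: (x - m).
Let z := x + (beta / (1 - beta)) *: (x - m).
Let z' := x' + (beta / (1 - beta)) *: (x' - x).
Hypothesis Xx : X x.
Hypothesis x'_min :
  is_argmin X (fun u => model x s u + gamma / 2 * enorm (u - y) ^+ 2) x'.

Let Xx' : X x'. Proof. by case: x'_min. Qed.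

Let b1 : 1 - beta != 0. Proof. by rewrite subr_eq0 gt_eqF. Qed.

(* A bound on [x' - y] would not do here: [y] may lie outside [X]. *)
Lemma step_size_le : enorm (x - m) <= L / kappa -> enorm (x' - x) <= L / kappa.
Proof.
have := argmin_three_point convX (model_wc s Xx) x'_min Xx.
have -> : x' - y = (x' - x) - beta *: (x - m).
  by rewrite /y opprD addrA.
have -> : x - y = - (beta *: (x - m)) by rewrite /y opprD addrA subrr add0r.
rewrite -(opprB x' x).
have := model_lipschitz s Xx Xx' Xx; rewrite enormB.
have := dot_young (x' - x) (x - m).
move: (x' - x) (x - m) => d' dd.
rewrite !dotE (dotC dd d') -!enorm_sqr.
move: (enorm_ge0 d') (enorm_ge0 dd).
move: (enorm d') (enorm dd) (dot d' dd) => e' e c e'0 e0 young lip tp eD.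
(* If e' exceeded L / kappa it would exceed e as well. The cross term is then at most e'^2, and the
   three-point inequality reduces to (gamma theta - lambda / 2) e'^2 <= L e', which contradicts the
   assumption by [theta_gamma]. *)
rewrite leNgt; apply/negP => De'.
have kD : kappa * (L / kappa) = L by rewrite mulrCA divff ?mulr1// gt_eqF.
have gb0 : 0 <= gamma * beta.
  by rewrite mulr_ge0// (le_trans lambda_ge0)// ltW.
have ee' : e ^+ 2 <= e' ^+ 2.
  by rewrite ler_pXn2r ?nnegrE// (le_trans eD)// ltW.
have h1 : gamma * beta * (2 * c) <= gamma * beta * (2 * e' ^+ 2).
  by rewrite ler_wpM2l//; lra.
have h2 : (gamma * theta - lambda / 2) * e' ^+ 2 <= L * e'.
  rewrite theta_def; lra.
have h3 : kappa * e' ^+ 2 <= L * e'.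
  by apply: le_trans h2; rewrite ler_wpM2r// sqr_ge0.
have e'1 : 0 < e' by apply: le_lt_trans De'; exact: le_trans eD.
have : kappa * e' <= L by rewrite -(ler_pM2r e'1) -mulrA -expr2.
have : kappa * (L / kappa) < kappa * e' by rewrite ltr_pM2l.
by rewrite kD; lra.
Qed.

Let M := moreau X f rho.
Let p := prox X f rho z.

(** One-step descent for the potential formed by a multiple of the envelope at z and a multiple of
    |x - m|^2. The cost is L^2 / kappa and the centred noise of the sample. The three-point
    inequality of the subproblem is combined with that of the proximal point p tested at x. *)
Lemma step_decrease : enorm (x' - x) <= L / kappa ->
  theta * (rho - lambda) / 2 * dot (z - p) (z - p) +
  theta * ((F x s - f x) - (F p s - f p)) <=
  ((gamma - lambda) * theta ^+ 2 / rho * M z + gamma * theta / 2 * enorm (x - m) ^+ 2) -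
  ((gamma - lambda) * theta ^+ 2 / rho * M z' + gamma * theta / 2 * enorm (x' - x) ^+ 2)
  + L ^+ 2 / kappa.
Proof.
move=> dD.
have Xp : X p by exact: prox_X.
have b01 : 0 <= beta <= 1 by rewrite beta_ge0 ltW.
(* With this comparison point every difference in the three-point inequality is theta times a
   difference of p, z and z'. *)
have Xu : X (beta *: x + (1 - beta) *: p) by exact: convex_setE.
have := argmin_three_point convX (model_wc s Xx) x'_min Xu.
have -> : x' - y = theta *: (z' - z).
  by apply/rowP => i; rewrite !mxE theta_def; field.
have -> : beta *: x + (1 - beta) *: p - x' = theta *: (p - z').
  by apply/rowP => i; rewrite !mxE theta_def; field.
have -> : beta *: x + (1 - beta) *: p - y = theta *: (p - z).
  by apply/rowP => i; rewrite !mxE theta_def; field.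
rewrite !(dotZl, dotZr).
have := (weakly_convexP _ _ _).1 (model_wc s Xx) beta x p b01 Xx Xp.
have := model_upper s Xx Xp.
have := model_lipschitz s Xx Xx' Xx.
have := prox_three_point X0 cX convX f_lb f_wc (ltW L_gt0) tau2_ge0 rho_gt0
  f_growth z Xx.
have := moreau_min z' Xp.
have := moreau_prox z.
rewrite -/M -/p model_exact// (enormB x x') !enorm_sqr.
rewrite (dotBB p z) (dotBB p z').
(* Since theta (z' - z) = (x' - x) - beta (x - m), Young's inequality on the cross term leaves the
   coefficients 1 - beta = theta and beta^2 - beta = - beta theta. *)
have eW : theta ^+ 2 * dot (z' - z) (z' - z) >=
    theta * dot (x' - x) (x' - x) - beta * theta * dot (x - m) (x - m).
  have -> : theta ^+ 2 * dot (z' - z) (z' - z) =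
      dot ((x' - x) - beta *: (x - m)) ((x' - x) - beta *: (x - m)).
    rewrite expr2 -mulrA -dotZr -dotZl; congr (dot _ _);
      by apply/rowP => i; rewrite !mxE theta_def; field.
  have := dot_young (x' - x) (x - m); move: (x' - x) (x - m) => d' dd.
  rewrite !dotE (dotC dd d') theta_def => young.
  have : beta * (2 * dot d' dd) <= beta * (dot d' d' + dot dd dd).
    by rewrite ler_wpM2l.
  lra.
have eG : theta ^+ 2 * dot (x - z) (x - z) = beta ^+ 2 * dot (x - m) (x - m).
  rewrite expr2 -mulrA -dotZr -dotZl expr2 -mulrA -dotZr -dotZl.
  have -> : theta *: (x - z) = - (beta *: (x - m)).
    by apply/rowP => i; rewrite !mxE theta_def; field.
  by rewrite dotNl dotNr opprK.
have W0 := dot_ge0 (x - p).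
have E20 := dot_ge0 (x - m).
have A0 := dot_ge0 (z - p).
move: eW eG W0 E20 A0 dD.
move: (dot (z' - z) _) (dot (x' - x) _) (dot (x - m) _) (dot (x - z) _)
  (dot (x - p) _) (dot (z - p) _) (dot (z' - p) _) (enorm (x' - x)).
move=> W D' D G S A B e' eW eG S0 D0 A0 e'D.
move: (M z) (M z') (f x) (f p) (F x s) (F p s) (model x s x') (model x s p) (model x s (_ + _)).
move=> Mz Mz' fx fp Fx Fp mx' mp mu' MzE Mz'le p3 lip up wc tp.
have t0 : 0 <= theta by exact: ltW.
have gamma_ge0 : 0 <= gamma by rewrite (le_trans lambda_ge0)// ltW.
have gl : 0 <= (gamma - lambda) * theta ^+ 2 / rho.
  by apply: divr_ge0 (ltW _) => //; rewrite mulr_ge0 ?sqr_ge0// subr_ge0 ltW.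
have rG : rho * G = v * D.
  apply: (@mulfI _ (theta ^+ 2)); first by rewrite expf_neq0// gt_eqF.
  by rewrite mulrCA eG mulrA -vE; ring.
(* Testing the envelope at z' with p bounds its decrease from below by rho / 2 times (A - B). *)
have h1 : (gamma - lambda) * theta ^+ 2 / 2 * (A - B) <=
    (gamma - lambda) * theta ^+ 2 / rho * (Mz - Mz').
  have -> : (gamma - lambda) * theta ^+ 2 / 2 * (A - B) =
      (gamma - lambda) * theta ^+ 2 / rho * (rho / 2 * (A - B)).
    by field; rewrite gt_eqF.
  by rewrite ler_wpM2l//; lra.
have h2 : theta * (fp + rho / 2 * A + (rho - mu) / 2 * S) <=
    theta * (fx + rho / 2 * G) by rewrite ler_wpM2l.
have h3 : theta * (mp - Fp) <= theta * (tau / 2 * S) by rewrite ler_wpM2l.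
have h5 : gamma / 2 * (theta * D' - beta * theta * D) <=
    gamma / 2 * (theta ^+ 2 * W) by rewrite ler_wpM2l// divr_ge0.
(* The summand rho beta^2 / theta^3 of gamma pays here for |x - z|^2, so that the coefficient of |x
   - m|^2 stays within gamma theta / 2 and the squares telescope. *)
have h6 : 0 <= theta / 2 * ((gamma * theta - v) * D).
  apply: mulr_ge0; first by rewrite divr_ge0.
  by rewrite mulr_ge0// gammaE addrK addr_ge0 ?mulr_ge0//; exact: ltW.
(* The distance from x to p is absorbed: mu + tau + lambda beta < 2 (tau + lambda) <= rho. *)
have h7 : 0 <= theta / 2 * ((rho - mu - tau - lambda * beta) * S).
  apply: mulr_ge0; first by rewrite divr_ge0.
  rewrite mulr_ge0//; have : lambda * beta <= lambda.
    by rewrite ler_piMr// ltW.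
  by move: mu_lt rho_ge; lra.
(* Weakens the coefficient rho - lambda theta of |z - p|^2 to rho - lambda. *)
have h8 : 0 <= theta * (lambda * (beta * A)) by rewrite !mulr_ge0.
have h9 : L * e' <= L ^+ 2 / kappa.
  by rewrite expr2 -mulrA ler_wpM2l// ltW.
have rG' : theta / 2 * (rho * G) = theta / 2 * (v * D) by rewrite rG.
have bE : beta = 1 - theta by rewrite theta_def; ring.
move: h1 h2 h3 h5 h6 h7 h8 h9 rG' lip wc tp; rewrite bE.
move: ((gamma - lambda) * theta ^+ 2 / rho) => g.
lra.
Qed.
End step.

(** * Summation over a run *)

Section run.
Variables (K : nat) (s : nat -> T) (x0 : 'rV[R]_d) (x : nat -> 'rV[R]_d).
Hypotheses (x0_in : X x0) (x_0 : x 0%N = x0) (x_1 : x 1%N = x0).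
Hypothesis x_step : forall k, (1 <= k <= K)%N ->
  is_argmin X (fun u => model (x k) (s k) u +
    gamma / 2 * enorm (u - extrapolate beta x k) ^+ 2) (x k.+1).

Lemma run_in k : (k <= K.+1)%N -> X (x k).
Proof.
case: k => [|[|k]] kK; [by rewrite x_0|by rewrite x_1|].
by have [] := x_step (k := k.+1) kK.
Qed.

(** Induction on k: since x^1 = x^0 the first displacement is zero, and [step_size_le] propagates
    the bound. *)
Lemma run_step_le k : (k <= K)%N -> enorm (x k.+1 - x k) <= L / kappa.
Proof.
elim: k => [_|k IH kK].
  rewrite x_0 x_1 subrr (_ : enorm 0 = 0) ?divr_ge0 ?ltW//.
  by apply/eqP; rewrite -sqrf_eq0 enorm_sqr -(scale0r 0) dotZl mul0r.
apply: (step_size_le (run_in _) (x_step _) (IH _)) => //; exact: ltnW.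
Qed.

Lemma run_bounded k : (k <= K.+1)%N -> `|x k| <= `|x0| + k%:R * (L / kappa).
Proof.
elim: k => [_|k IH kK]; first by rewrite x_0 mul0r addr0.
have -> : x k.+1 = x k + (x k.+1 - x k) by rewrite addrC subrK.
rewrite (le_trans (ler_normD _ _))// -natr1 mulrDl mul1r addrA lerD//.
  by apply: IH; exact: ltnW.
by rewrite (le_trans (norm_le_enorm _))// run_step_le.
Qed.

Let z k := extrapolate (beta / (1 - beta)) x k.
Let p k := prox X f rho (z k).

(** The potential [Phi] telescopes. It starts at a multiple of the envelope at x0, because x^1 = x^0
    gives z^1 = x0, and it ends above the same multiple of the infimum of f, because the envelope is
    at least f at the proximal point. *)
Lemma run_sum :
  theta * (rho - lambda) / 2 * (\sum_(1 <= k < K.+1) dot (z k - p k) (z k - p k)) +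
  theta * (\sum_(1 <= k < K.+1)
    ((F (x k) (s k) - f (x k)) - (F (p k) (s k) - f (p k)))) <=
  (gamma - lambda) * theta ^+ 2 / rho * (moreau X f rho x0 - minval X f) +
  K%:R * (L ^+ 2 / kappa).
Proof.
pose g := (gamma - lambda) * theta ^+ 2 / rho.
pose Phi k := g * moreau X f rho (z k) + gamma * theta / 2 * enorm (x k - x k.-1) ^+ 2.
have H j : (j <= K)%N ->
  theta * (rho - lambda) / 2 * (\sum_(1 <= k < j.+1) dot (z k - p k) (z k - p k)) +
  theta * (\sum_(1 <= k < j.+1)
    ((F (x k) (s k) - f (x k)) - (F (p k) (s k) - f (p k)))) <=
  Phi 1%N - Phi j.+1 + j%:R * (L ^+ 2 / kappa).
  elim: j => [_|j IH jK]; first by rewrite !big_geq// !mulr0 mul0r; lra.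
  rewrite !(@big_nat_recr _ _ _ j.+1)//=.
  have := IH (ltnW jK).
  have : theta * (rho - lambda) / 2 * dot (z j.+1 - p j.+1) (z j.+1 - p j.+1) +
      theta * ((F (x j.+1) (s j.+1) - f (x j.+1)) - (F (p j.+1) (s j.+1) - f (p j.+1))) <=
      Phi j.+1 - Phi j.+2 + L ^+ 2 / kappa.
    exact: step_decrease (run_in (ltnW jK : j.+1 <= K.+1)%N) (x_step (k := j.+1) jK)
      (run_step_le jK).
  move: (Phi _) (Phi _) (Phi _) (dot _ _) (F _ _ - _ - _) (\sum_(_ <= _ < _) _)
    (\sum_(_ <= _ < _) _) => P1 P2 P3 A N SA SN.
  by rewrite -natr1; lra.
apply: le_trans (H K (leqnn K)) _.
rewrite lerD2r.
have g0 : 0 <= g.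
  apply: divr_ge0 (ltW _) => //; rewrite mulr_ge0 ?sqr_ge0// subr_ge0.
  exact: ltW.
have Phi1 : Phi 1%N = g * moreau X f rho x0.
  rewrite /Phi /z /extrapolate /= x_0 x_1 subrr scaler0 addr0.
  by rewrite enorm_sqr -(scale0r 0) dotZl mul0r mulr0 addr0.
have PhiK : g * minval X f <= Phi K.+1.
  rewrite -[leLHS]addr0 lerD//; last first.
    rewrite mulr_ge0 ?sqr_ge0// divr_ge0// mulr_ge0//; last exact: ltW.
    by rewrite (le_trans lambda_ge0)// ltW.
  rewrite ler_wpM2l// moreau_prox -[leLHS]addr0 lerD//.
    by apply: ge_inf => //; exists (prox X f rho (z K.+1)).
  by rewrite mulr_ge0 ?dot_ge0// divr_ge0// ltW.
by rewrite Phi1 mulrBr lerD2l lerN2.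
Qed.
End run.
End path.

(** * Expectations *)

Section objective.
Context {R : realType} {d : nat} {dT : measure_display} {T : measurableType dT}.
Variables (Xi : probability T R) (X : set 'rV[R]_d) (F : 'rV[R]_d -> T -> R).
Hypothesis F_integrable : forall u, X u -> Xi.-integrable setT (EFin \o F u).
Let f := objective Xi F.

Lemma objectiveE u : X u -> (\int[Xi]_s (F u s)%:E = (f u)%:E)%E.
Proof.
move=> Xu; rewrite /f /objective unlock fineK//.
exact: integrable_fin_num (F_integrable Xu).
Qed.

Let cst_int (c : R) : (\int[Xi]_s (cst c%:E s) = c%:E)%E.
Proof. by rewrite integral_cst//= probability_setT mule1. Qed.

Lemma objective_weakly_convex mu : convex_set X ->
  (forall s, weakly_convex X mu (fun u => F u s)) -> weakly_convex X mu f.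
Proof.
move=> convX wF; apply/weakly_convexP => t u v t01 Xu Xv.
set c := mu / 2 * _ * _; have cE : c = mu / 2 * (t * (1 - t)) * dot (u - v) (u - v) by [].
clearbody c.
have Xw : X (t *: u + (1 - t) *: v) by exact: convex_setE.
have iu := F_integrable Xu; have iv := F_integrable Xv.
have itu : Xi.-integrable setT (fun s => t%:E * (F u s)%:E)%E.
  by apply: integrableZl.
have itv : Xi.-integrable setT (fun s => (1 - t)%:E * (F v s)%:E)%E.
  by apply: integrableZl.
have ic : Xi.-integrable setT (cst c%:E) by exact: finite_measure_integrable_cst.
rewrite -lee_fin !EFinD !EFinM -!objectiveE// -[c%:E]cst_int.
rewrite -(integralZl _ iu)// -(integralZl _ iv)//.
rewrite -integralD// -integralD//; last exact: integrableD.
apply: le_integral => //; first exact: F_integrable.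
- by apply: integrableD => //; exact: integrableD.
- move=> s _; rewrite /= -!EFinM -!EFinD lee_fin cE.
  exact: (weakly_convexP _ _ _).1 (wF s) t u v t01 Xu Xv.
Qed.

Lemma objective_le u v c : X u -> X v ->
  (forall s, F u s - F v s <= c) -> f u - f v <= c.
Proof.
move=> Xu Xv Fuv; rewrite lerBlDl -lee_fin EFinD -!objectiveE//.
have iv := F_integrable Xv.
have ic : Xi.-integrable setT (cst c%:E) by exact: finite_measure_integrable_cst.
rewrite -[c%:E]cst_int -integralD//; apply: le_integral => //.
- exact: F_integrable.
- exact: integrableD.
- by move=> s _ /=; rewrite lee_fin; have := Fuv s; lra.
Qed.

Lemma objective_centered u : X u ->
  Xi.-integrable setT (EFin \o (fun s => F u s - f u)) /\
  (\int[Xi]_s (F u s - f u)%:E = 0)%E.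
Proof.
move=> Xu; have iu := F_integrable Xu.
have ic : Xi.-integrable setT (cst (f u)%:E) by exact: finite_measure_integrable_cst.
split; first exact: (integrableB _ iu ic).
under eq_integral do rewrite EFinB.
by rewrite (integralB _ iu ic)// objectiveE// cst_int subee.
Qed.

End objective.

Section nonneg_integral.
Context {R : realType} {dO : measure_display} {O : measurableType dO}.
Variable P : probability O R.
Local Open Scope ereal_scope.

(** The integral of a nonnegative function is the supremum over the simple functions below it, so
    monotonicity holds for arbitrary nonnegative integrands. *)
Lemma ge0_le_integral_nonmeas (g h : O -> \bar R) :
  (forall w, 0 <= g w) -> (forall w, g w <= h w) ->
  \int[P]_w g w <= \int[P]_w h w.
Proof.
move=> g0 gh; have h0 w : 0 <= h w := le_trans (g0 w) (gh w).
rewrite !ge0_integralTE//; apply: le_ereal_sup => _ [k kg <-]; exists k => // w.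
exact: le_trans (kg w) (gh w).
Qed.

(** The case of [ge0_integral_indep] where [g] is the independent variable, with its own
    distribution as law; the absolute value serves as a nonnegative test function on all of R. *)
Lemma ge0_integral_indep_fun (A : set O) (g : O -> R) :
  measurable A -> measurable_fun setT g -> (forall w, (0 <= g w)%R) ->
  (forall B, measurable B -> P (A `&` g @^-1` B) = P A * P (g @^-1` B)) ->
  \int[P]_(w in A) (g w)%:E = P A * \int[P]_w (g w)%:E.
Proof.
move=> mA mg g0 indep.
pose G : {mfun O >-> R} := HB.pack g (isMeasurableFun.Build _ _ _ _ g mg).
have mh : measurable_fun setT (fun t : R => `|t|%:E).
  by apply/measurable_EFinP; exact: normr_measurable.
have h0 (t : R) : 0 <= `|t|%:E by rewrite lee_fin.
transitivity (\int[P]_(w in A) `|g w|%:E).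
  by apply: eq_integral => w _; rewrite ger0_norm.
rewrite (ge0_integral_indep (Xi := distribution P G) mg mA indep mh h0).
rewrite ge0_integral_pushforward//.
by congr (_ * _); apply: eq_integral => w _ /=; rewrite ger0_norm.
Qed.

End nonneg_integral.

(** * Averaging over a uniformly random index *)

Section uniform_index.
Context {R : realType} {dO : measure_display} {O : measurableType dO}.
Variables (P : probability O R) (K : nat) (kstar : O -> nat) (G : nat -> O -> R).
Hypotheses (K_ge1 : (1 <= K)%N) (mkstar : measurable_fun setT kstar).
Hypothesis kstar_uniform : forall k, (1 <= k <= K)%N ->
  P (kstar @^-1` [set k]) = (K%:R^-1)%:E.
Hypothesis G_ge0 : forall k w, 0 <= G k w.
Hypothesis mG : forall k, (1 <= k <= K)%N -> measurable_fun setT (G k).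
Hypothesis G_indep : forall k, (1 <= k <= K)%N -> forall B, measurable B ->
  P (kstar @^-1` [set k] `&` G k @^-1` B) =
  (P (kstar @^-1` [set k]) * P (G k @^-1` B))%E.

Let A k := kstar @^-1` [set k].
Let D j := kstar @^-1` [set k | (1 <= k <= j)%N].

Let mpre (S : set nat) : measurable (kstar @^-1` S).
Proof. by rewrite -[X in measurable X]setTI; exact: mkstar. Qed.

(** At j = K this says that [kstar] lies in [1, K] almost surely. *)
Let PD j : (j <= K)%N -> P (D j) = (j%:R / K%:R)%:E.
Proof.
elim: j => [_|j IH jK].
  rewrite mul0r (_ : D 0 = set0) ?measure0//.
  by apply/seteqP; split => w //=; rewrite /D /=; case: (kstar w).
rewrite (_ : D j.+1 = D j `|` A j.+1).
  rewrite measureU//; [|exact: mpre|exact: mpre|].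
  - rewrite [X in (X + _)%E]IH ?(ltnW jK)// [X in (_ + X)%E]kstar_uniform//.
    by rewrite -EFinD -natr1 mulrDl mul1r.
  - apply/seteqP; split => w //=; rewrite /D /A /= => -[/andP[_ kj] kE].
    by rewrite kE ltnn in kj.
apply/seteqP; split => w; rewrite /D /A /=.
  by move=> /andP[k1]; rewrite leq_eqVlt => /orP[/eqP->|]; [right|rewrite ltnS k1; left].
by case=> [/andP[-> /leqW]|->]//; rewrite /= ltnS leqnn.
Qed.

(* [G k] is arbitrary for [k] outside [1, K], so the integrand need not be
   measurable on the null event where [kstar] leaves that range. *)
Lemma uniform_index_integral_le :
  (\int[P]_w (G (kstar w) w)%:E <=
   (K%:R^-1)%:E * \sum_(1 <= k < K.+1) \int[P]_w (G k w)%:E)%E.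
Proof.
pose N := ~` D K.
have mN : measurable N by apply: measurableC; exact: mpre.
have K0 : K%:R != 0 :> R by rewrite pnatr_eq0 -lt0n.
have PN : P N = 0%E.
  rewrite probability_setC; last exact: mpre.
  by rewrite PD// divff// subee.
pose GA k : O -> \bar R := if (1 <= k <= K)%N then (EFin \o G k) \_ (A k) else cst 0%E.
(* On the null event the value +oo dominates whatever the integrand is there, and its integral is
   still 0. *)
pose I : O -> \bar R := (cst +oo%E) \_ N.
have GA0 k w : (0 <= GA k w)%E.
  rewrite /GA; case: ifP => // _.
  by apply: erestrict_ge0 => t _; rewrite lee_fin.
have I0 w : (0 <= I w)%E by apply: erestrict_ge0 => t _; exact: leey.
have mGA k : measurable_fun setT (GA k).
  rewrite /GA; case: ifP => // k1K; apply/(measurable_restrictT _ (mpre _)).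
  by apply: measurable_funTS; apply/measurable_EFinP; exact: mG.
have mI : measurable_fun setT I by apply/(measurable_restrictT _ mN).
pose S w := (\sum_(1 <= k < K.+1) GA k w)%E.
have mS : measurable_fun setT S by exact: emeasurable_sum.
have S0 w : (0 <= S w)%E by apply: sume_ge0.
apply: (@le_trans _ _ (\int[P]_w (S w + I w))%E).
  apply: ge0_le_integral_nonmeas => w; first by rewrite lee_fin.
  have [Dw|nDw] := pselect (D K w); last first.
    rewrite /I patchE mem_set//= addey ?leey// -ltNye (lt_le_trans _ (S0 w))//.
  rewrite -[leLHS]adde0 leeD//.
  rewrite /S (big_rem (kstar w)) /=; last by rewrite mem_index_iota.
  rewrite {1}/GA (Dw : (1 <= kstar w <= K)%N) patchE mem_set//= leeDl//.
  exact: sume_ge0.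
rewrite ge0_integralD// -[X in (_ + X)%E]integral_mkcond integral_cst//.
rewrite [X in (_ + _ * X)%E]PN mule0 adde0.
rewrite /S ge0_integral_sum// ge0_sume_distrr; last first.
  by move=> k _; apply: integral_ge0 => w _; rewrite lee_fin.
rewrite le_eqVlt; apply/orP; left; apply/eqP.
rewrite [LHS]big_nat [RHS]big_nat; apply: eq_bigr => k; rewrite ltnS => k1K.
rewrite /GA k1K -integral_mkcond.
rewrite (ge0_integral_indep_fun (mpre _) (mG k1K) (G_ge0 k) (G_indep k1K)).
by rewrite [X in (X * _)%E](kstar_uniform k1K).
Qed.
End uniform_index.

(** * The convergence rate *)

Section history.
Context {R : realType} {dO dT : measure_display} {O : measurableType dO}.
Context {T : measurableType dT} {d : nat}.
Variables (xi : nat -> O -> T).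
Hypothesis mxi : forall j, measurable_fun setT (xi j).

Let gen k : set_system O :=
  \bigcup_(j in [set j | (1 <= j <= k)%N]) g_sigma_algebra_preimage (xi j).

Lemma history_measurable k : history xi k `<=` measurable.
Proof.
apply: smallest_sub; first exact: sigma_algebra_measurable.
by move=> _ [j _ [D mD <-]]; exact: mxi.
Qed.

Lemma history_le k k' : (k <= k')%N -> history xi k `<=` history xi k'.
Proof.
move=> kk'; apply: smallest_sub; first exact: smallest_sigma_algebra.
move=> S [j /= /andP[j1 jk] jS]; apply: sub_gen_smallest; exists j => //=.
by rewrite j1 (leq_trans jk).
Qed.

(* Measurability with respect to [history xi k] is expressed through the
   measurable type generated by the same set system. *)
Definition history_fun k (g : O -> R) : Prop :=
  measurable_fun setT (g : g_sigma_algebraType (gen k) -> R).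

Lemma history_funP k g :
  history_fun k g <-> (forall B, measurable B -> history xi k (g @^-1` B)).
Proof.
split=> [mg B mB|mg _ B mB]; last by rewrite setTI; exact: mg.
by rewrite -[X in history _ _ X]setTI; exact: mg.
Qed.

Lemma history_fun_le k k' g : (k <= k')%N -> history_fun k g -> history_fun k' g.
Proof.
by move=> kk' /history_funP mg; apply/history_funP => B mB; apply: (history_le kk'); exact: mg.
Qed.

Lemma history_fun_measurable k g : history_fun k g -> measurable_fun setT g.
Proof.
move=> /history_funP mg _ B mB; rewrite setTI.
by apply: (@history_measurable k); exact: mg.
Qed.
End history.

Theorem theorem4p2 (R : realType) (d : nat) (X : set 'rV[R]_d)
    (* the sample space with the distribution Xi, and the probability space *)
    (dT : measure_display) (T : measurableType dT) (Xi : probability T R)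
    (dO : measure_display) (O : measurableType dO) (P : probability O R)
    (* F x s = f(x,s) and model x s y = f_x(y,s) *)
    (F : 'rV[R]_d -> T -> R) (model : 'rV[R]_d -> T -> 'rV[R]_d -> R)
    (lambda tau L mu rho beta theta gamma0 gamma Delta : R) (K : nat)
    (xi : nat -> {RV P >-> T}) (kstar : {RV P >-> nat})
    (x0 : 'rV[R]_d) (x : nat -> O -> 'rV[R]_d)
    (f := objective Xi F)
    (y := fun (k : nat) (w : O) => extrapolate beta (fun j => x j w) k)
    (z := fun (k : nat) (w : O) =>
            extrapolate (beta / (1 - beta)) (fun j => x j w) k)
    (X_nonempty : X !=set0) (X_closed : closed X) (X_convex : convex_set X)
    (F_integrable : forall u, X u -> Xi.-integrable setT (EFin \o F u))
    (f_bounded_below : has_lbound [set f u | u in X])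
    (lambda_ge0 : 0 <= lambda) (tau_ge0 : 0 <= tau) (L_gt0 : 0 < L)
    (F_continuous : forall s, {within X, continuous (fun u => F u s)})
    (F_weakly_convex : forall s, weakly_convex X mu (fun u => F u s))
    (mu_lt : mu < lambda + tau)
    (model_weakly_convex : forall u s, X u -> weakly_convex X lambda (model u s))
    (model_exact : forall u s, X u -> model u s u = F u s)
    (model_upper : forall u v s, X u -> X v ->
      model u s v - F v s <= tau / 2 * enorm (u - v) ^+ 2)
    (model_lipschitz : forall u v v' s, X u -> X v -> X v' ->
      model u s v' - model u s v <= L * enorm (v' - v))
    (rho_gt0 : 0 < rho) (rho_ge : 2 * (tau + lambda) <= rho)
    (beta_ge0 : 0 <= beta) (beta_lt1 : beta < 1) (theta_def : theta = 1 - beta)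
    (K_ge1 : (1 <= K)%N) (gamma0_gt0 : 0 < gamma0)
    (gamma_def : gamma = gamma0 * theta^-1 * Num.sqrt K%:R + lambda
                         + rho * beta ^+ 2 * theta ^- 3)
    (xi_law : forall k, (1 <= k <= K)%N ->
      forall A, measurable A -> distribution P (xi k) A = Xi A)
    (xi_independent : mutually_independent P [set k | (1 <= k <= K)%N]
      (fun k => g_sigma_algebra_preimage (xi k)))
    (kstar_uniform : forall k, (1 <= k <= K)%N ->
      P (kstar @^-1` [set k]) = (K%:R^-1)%:E)
    (kstar_independent : independent_systems P
      (g_sigma_algebra_preimage kstar) (history (fun k => xi k : O -> T) K))
    (x0_in : X x0) (x_0 : forall w, x 0%N w = x0) (x_1 : forall w, x 1%N w = x0)
    (x_step : forall k w, (1 <= k <= K)%N ->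
      is_argmin X
        (fun u => model (x k w) (xi k w) u
                  + gamma / 2 * enorm (u - y k w) ^+ 2)
        (x k.+1 w))
    (x_measurable : forall k, (1 <= k <= K)%N ->
      vector_measurable (history (fun k => xi k : O -> T) k) (x k.+1))
    (Delta_def : Delta = moreau X f rho x0 - minval X f) :
  ('E_P[fun w => (enorm (gradient (moreau X f rho) (z (kstar w) w)) ^+ 2)%R]
   <= (2 * rho / (rho - lambda)
       * (rho * beta ^+ 2 * theta ^- 2 * Delta / K%:R
          + (gamma0 * Delta + rho * L ^+ 2 / (theta * gamma0))
            * (Num.sqrt K%:R)^-1))%:E)%E.
Proof.
(* [kappa] and [v] are the two summands of theta (gamma - lambda). *)
pose kappa := gamma0 * Num.sqrt K%:R.
pose v := rho * beta ^+ 2 * theta ^- 2.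
have K_gt0 : 0 < K%:R :> R by rewrite ltr0n.
have sqrtK_gt0 : 0 < Num.sqrt K%:R :> R by rewrite sqrtr_gt0.
have theta_gt0 : 0 < theta by rewrite theta_def subr_gt0.
have theta_neq0 : theta != 0 by rewrite gt_eqF.
have kappa_gt0 : 0 < kappa by rewrite mulr_gt0.
have vE : v * theta ^+ 2 = rho * beta ^+ 2 by rewrite /v divfK// expf_neq0.
have gammaE : gamma * theta = kappa + lambda * theta + v.
  by rewrite gamma_def /kappa /v; field.
have rho_lambda : lambda < rho by move: lambda_ge0 tau_ge0 rho_ge rho_gt0; lra.
have mu_rho : mu < rho by lra.
have tau2_ge0 : 0 <= tau / 2 by rewrite divr_ge0.
(* Exactness at u, the Lipschitz bound of the model at u and its upper accuracy at u' combine; the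
   bound is uniform in s and therefore passes to f. *)
have F_growth u u' s : X u -> X u' ->
    F u s - F u' s <= L * enorm (u - u') + tau / 2 * enorm (u - u') ^+ 2.
  move=> Xu Xu'; have := model_lipschitz u u' u s Xu Xu' Xu.
  by have := model_upper u u' s Xu Xu'; rewrite model_exact//; lra.
have f_growth u u' : X u -> X u' ->
    f u - f u' <= L * enorm (u - u') + tau / 2 * enorm (u - u') ^+ 2.
  move=> Xu Xu'; apply: (objective_le F_integrable) => // s.
  exact: F_growth.
have f_wc : weakly_convex X mu f.
  exact: (objective_weakly_convex F_integrable X_convex F_weakly_convex).
pose prx := prox X f rho.
have prx_in u : X (prx u).
  exact: (prox_in X_nonempty X_closed f_bounded_below (ltW L_gt0) tau2_ge0 rho_gt0 f_growth).
have mxi j : measurable_fun setT (xi j) by exact: measurable_funP.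
have cb : 1 - beta != 0 by rewrite -theta_def.
pose xi' : nat -> O -> T := fun k => xi k.
have mxi' j : measurable_fun setT (xi' j) by exact: mxi.
pose c := beta / (1 - beta).
pose zz k w := x k w + c *: (x k w - x k.-1 w).
pose A k w := dot (zz k w - prx (zz k w)) (zz k w - prx (zz k w)).
pose h u s := F u s - f u.
(* The value 0 outside [1, K] makes [n k] integrable and centred for every index. *)
pose n k w := if (1 <= k <= K)%N
  then h (x k w) (xi k w) - h (prx (zz k w)) (xi k w) else 0.
pose C := (kappa + v) * theta / rho * Delta + K%:R * (L ^+ 2 / kappa).
have run w : theta * (rho - lambda) / 2 * (\sum_(1 <= k < K.+1) A k w) +
    theta * (\sum_(1 <= k < K.+1) n k w) <= C.
  have := @run_sum R d T X F f model lambda tau L mu rho beta theta gamma kappa v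
    X_nonempty X_closed X_convex f_bounded_below f_wc f_growth lambda_ge0 tau_ge0
    L_gt0 mu_lt model_weakly_convex model_exact model_upper model_lipschitz rho_gt0 rho_ge
    beta_ge0 beta_lt1 theta_def kappa_gt0 vE gammaE
    K (fun k => xi k w) x0 (fun k => x k w) x0_in (x_0 w) (x_1 w) (fun k => x_step k w).
  rewrite -Delta_def (_ : (gamma - lambda) * theta ^+ 2 / rho = (kappa + v) * theta / rho).
    rewrite /C; congr (_ + _ * _ <= _).
    by apply: eq_big_nat => k; rewrite ltnS /n => ->.
  by rewrite expr2 mulrA mulrBl gammaE addrAC addrK.
have x_in k w : (k <= K.+1)%N -> X (x k w).
  exact: (run_in x0_in (x_0 w) (x_1 w) (fun k => x_step k w)).
pose B := `|x0| + K.+1%:R * (L / kappa).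
have x_bounded k w : (k <= K.+1)%N -> `|x k w| <= B.
  move=> kK; apply: le_trans (run_bounded X_convex lambda_ge0 tau_ge0 L_gt0
    model_weakly_convex model_lipschitz rho_gt0 rho_ge beta_ge0 beta_lt1 theta_def kappa_gt0
    vE gammaE x0_in (x_0 w) (x_1 w) (fun k => x_step k w) kK) _.
  by rewrite lerD2l ler_wpM2r ?ler_nat// divr_ge0// ltW.
(* The iterate x^k depends on the samples up to k - 1 only. For k = 0 and k = 1 it is constant,
   hence measurable for the trivial history of index 0. *)
have x_meas k i : (k <= K.+1)%N -> history_fun xi' k.-1 (fun w => x k w ord0 i).
  case: k => [|[|k]] kK.
  - by under eq_fun do rewrite x_0; exact: measurable_cst.
  - by under eq_fun do rewrite x_1; exact: measurable_cst.
  - by apply/history_funP => S mS; exact: (x_measurable k.+1).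
have z_meas k i : (1 <= k <= K)%N -> history_fun xi' k.-1 (fun w => zz k w ord0 i).
  move=> /andP[k1 kK]; have kK1 := leqW kK.
  have mx := x_meas k i kK1.
  have mx' : history_fun xi' k.-1 (fun w => x k.-1 w ord0 i).
    apply: history_fun_le (x_meas k.-1 i _); first exact: leq_pred.
    by rewrite (leq_trans (leq_pred k)).
  rewrite /zz; under eq_fun do rewrite !mxE.
  by apply: measurable_funD => //; apply: measurable_funM => //; exact: measurable_funB.
have prx_cont i := prox_coord_continuous X_nonempty X_closed X_convex f_bounded_below f_wc
  (ltW L_gt0) tau2_ge0 rho_gt0 mu_rho f_growth (i := i).
have p_meas k i : (1 <= k <= K)%N -> history_fun xi' k.-1 (fun w => prx (zz k w) ord0 i).
  move=> kK; exact: (@measurable_fun_continuous_comp R d _ (g_sigma_algebraType _) (zz k)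
    (fun j => z_meas k j kK) _ (prx_cont i)).
have A_meas k : (1 <= k <= K)%N -> history_fun xi' k.-1 (A k).
  move=> kK.
  have -> : A k = fun w => \sum_i (zz k w ord0 i - prx (zz k w) ord0 i) *
                                  (zz k w ord0 i - prx (zz k w) ord0 i).
    apply/funext => w; apply: eq_bigr => i _.
    by move: (prx (zz k w)) (zz k w) => p q; rewrite !mxE.
  apply: measurable_sum => i; have mB := measurable_funB (z_meas k i kK) (p_meas k i kK).
  exact: measurable_funM.
(* Both F(.,s) and f obey the same growth bound, so each contributes e / 2. *)
have h_cont (e : R) : 0 < e -> exists2 delta : R, 0 < delta &
    forall u u', X u -> X u' -> `|u - u'| < delta -> forall s, `|h u s - h u' s| <= e.
  move=> e0; have e20 : 0 < e / 2 by rewrite divr_gt0.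
  have [delta delta0 small] := growth_small d (ltW L_gt0) tau2_ge0 e20.
  exists delta => // u u' Xu Xu' uu' s; have := small u u' uu'.
  have := f_growth u u' Xu Xu'; have := f_growth u' u Xu' Xu.
  have := F_growth u u' s Xu Xu'; have := F_growth u' u s Xu' Xu.
  rewrite (enormB u' u) /h; move: (f u) (f u') (F u s) (F u' s).
  move: (L * _ + _) => r fu fu' Fu Fu' h1 h2 h3 h4 h5.
  by rewrite ler_norml; apply/andP; split; lra.
have frozen k (Y : O -> 'rV[R]_d) (r : R) : (1 <= k <= K)%N ->
    (forall i, history_fun xi' k.-1 (fun w => Y w ord0 i)) ->
    (forall w, X (Y w)) -> (forall w, `|Y w| <= r) ->
    P.-integrable setT (EFin \o (fun w => h (Y w) (xi k w))) /\
    (\int[P]_w (h (Y w) (xi k w))%:E = 0)%E.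
  move=> k1K mY YX Yr.
  apply: (@frozen_centered R d _ O _ T P Xi (xi k) X h _ Y r (mxi k)
    (history_measurable mxi (k := k.-1)) _ X_closed _ _ h_cont mY YX Yr).
  - move=> S S' hS mS'; rewrite -(xi_law k k1K _ mS').
    have /andP[k0 kK] := k1K.
    apply: (history_independent mxi xi_independent _ hS); first by rewrite prednK.
    by exists S' => //; rewrite setTI prednK.
  - by move=> u Xu; have [] := objective_centered F_integrable Xu.
  - by move=> u Xu; have [] := objective_centered F_integrable Xu.
have n_centered k : P.-integrable setT (EFin \o n k) /\ (\int[P]_w (n k w)%:E = 0)%E.
  have [k1K|/negPf nk] := boolP (1 <= k <= K)%N; last first.
    have -> : n k = cst 0 by apply/funext => w; rewrite /n nk.
    by split; [exact: integrable0|rewrite integral0_eq].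
  have -> : n k = fun w => h (x k w) (xi k w) - h (prx (zz k w)) (xi k w).
    by apply/funext => w; rewrite /n k1K.
  have kK1 : (k <= K.+1)%N by case/andP: k1K => _ /leqW.
  have kK1' : (k.-1 <= K.+1)%N by rewrite (leq_trans (leq_pred k)).
  have [i1 c1] := @frozen k (x k) B k1K
    (fun i => x_meas k i kK1) (fun w => x_in k w kK1) (fun w => x_bounded k w kK1).
  (* Iterates bounded by B give |z^k| <= B + |c| (B + B), and the Lipschitz bound of the proximal
     map turns this into a bound for p^k. *)
  pose r := `|prx 0| + rho / (rho - mu) * (Num.sqrt d%:R * (B + `|c| * (B + B))).
  have pr w : `|prx (zz k w)| <= r.
    apply: le_trans (prox_norm_le X_nonempty X_closed X_convex f_bounded_below f_wc
      (ltW L_gt0) tau2_ge0 rho_gt0 mu_rho f_growth _) _.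
    rewrite lerD2l ler_wpM2l//; first by rewrite divr_ge0 ?subr_ge0 ?ltW.
    rewrite ler_wpM2l// ?sqrtr_ge0// /zz (le_trans (ler_normD _ _))// lerD ?x_bounded//.
    rewrite normrZ ler_wpM2l// (le_trans (ler_normB _ _))//.
    by rewrite lerD ?x_bounded.
  have [i2 c2] := @frozen k (fun w => prx (zz k w)) r k1K
    (fun i => p_meas k i k1K) (fun w => prx_in _) pr.
  split; first exact: (integrableB _ i1 i2).
  under eq_integral do rewrite EFinB.
  by rewrite (integralB _ i1 i2)// c1 c2 subee.
pose A' k := if (1 <= k <= K)%N then A k else cst 0.
have A'E k : (1 <= k <= K)%N -> A' k = A k by rewrite /A' => ->.
have A_ge0 k w : 0 <= A k w by exact: dot_ge0.
have A'_ge0 k w : 0 <= A' k w by rewrite /A'; case: ifP.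
have mA k : (1 <= k <= K)%N -> measurable_fun setT (A k).
  by move=> kK; exact: (history_fun_measurable mxi') (A_meas k kK).
have mA' k : measurable_fun setT (A' k).
  by rewrite /A'; case: ifP => [|_]; [exact: mA|exact: measurable_cst].
pose c0 := theta * (rho - lambda) / 2.
have c0_gt0 : 0 < c0 by rewrite divr_gt0// mulr_gt0// subr_gt0.
pose N w := \sum_(1 <= k < K.+1) n k w.
have sumN w : (N w)%:E = (\sum_(1 <= k < K.+1) (n k w)%:E)%E by rewrite sumEFin.
have iN : P.-integrable setT (EFin \o N).
  rewrite (_ : EFin \o N = fun w => \sum_(1 <= k < K.+1) (n k w)%:E)%E.
    by apply: integrable_sum => // k _; have [] := n_centered k.
  by apply/funext => w; exact: sumN.
have N0 : (\int[P]_w (N w)%:E = 0)%E.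
  under eq_integral do rewrite sumN.
  rewrite integral_sum//; last by move=> k; have [] := n_centered k.
  by rewrite big1// => k _; have [] := n_centered k.
(* The path inequality divided by [c0]: the sum of the [A k] is at most [H], whose expectation is C
   / c0 because the noise is centred. *)
pose H w := C / c0 - theta / c0 * N w.
have iH : P.-integrable setT (EFin \o H) /\ (\int[P]_w (H w)%:E = (C / c0)%:E)%E.
  have ic : P.-integrable setT (cst (C / c0)%:E) by exact: finite_measure_integrable_cst.
  have iZ : P.-integrable setT (fun w => (theta / c0)%:E * (N w)%:E)%E by exact: integrableZl.
  split; first exact: (integrableB _ ic iZ).
  under eq_integral do rewrite EFinB EFinM.
  rewrite (integralB _ ic iZ)// (integralZl _ iN)// N0 mule0 sube0.
  by rewrite integral_cst//= probability_setT mule1.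
have sumA : (\sum_(1 <= k < K.+1) \int[P]_w (A' k w)%:E <= (C / c0)%:E)%E.
  rewrite -ge0_integral_sum//; last 2 first.
  - by move=> k; exact/measurable_EFinP.
  - by move=> k w _; rewrite lee_fin.
  rewrite -iH.2; apply: ge0_le_integral => //.
  - by move=> w _; apply: sume_ge0 => k _; rewrite lee_fin.
  - by apply: emeasurable_sum => k; exact/measurable_EFinP.
  - by have /measurable_int := iH.1.
  - move=> w _; rewrite sumEFin lee_fin /H.
    rewrite -(ler_pM2l c0_gt0) mulrBr mulrCA divff ?gt_eqF// mulr1.
    rewrite mulrA mulrCA divff ?gt_eqF// mulr1.
    have := run w; rewrite -/c0 -/(N w).
    have -> : \sum_(1 <= k < K.+1) A k w = \sum_(1 <= k < K.+1) A' k w.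
      by apply: eq_big_nat => k; rewrite ltnS => kK; rewrite A'E.
    lra.
pose G k w := rho ^+ 2 * A k w.
have r2 : 0 <= rho ^+ 2 by exact: sqr_ge0.
have gradE w : enorm (gradient (moreau X f rho) (z (kstar w) w)) ^+ 2 = G (kstar w) w.
  rewrite (gradient_moreau X_nonempty X_closed X_convex f_bounded_below f_wc (ltW L_gt0)
    tau2_ge0 rho_gt0 mu_rho f_growth).
  by rewrite enorm_sqr dotZl dotZr mulrA -expr2.
rewrite unlock; under eq_integral do rewrite gradE.
have G_history k : (1 <= k <= K)%N -> history_fun xi' K (G k).
  move=> kK; apply: measurable_funM => //.
  apply: history_fun_le (A_meas k kK); have /andP[_] := kK.
  exact/leq_trans/leq_pred.
apply: le_trans (@uniform_index_integral_le R _ O P K kstar G K_ge1 _ kstar_uniform _ _ _) _.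
- exact: measurable_funP.
- by move=> k w; rewrite mulr_ge0.
- by move=> k kK; exact: (history_fun_measurable mxi') (G_history k kK).
- move=> k kK S mS; apply: kstar_independent.
    by exists [set k] => //; rewrite setTI.
  by apply: (iffLR (history_funP _ _ _)) => //; exact: G_history.
have -> : (\sum_(1 <= k < K.+1) \int[P]_w (G k w)%:E =
    (rho ^+ 2)%:E * \sum_(1 <= k < K.+1) \int[P]_w (A' k w)%:E)%E.
  rewrite ge0_sume_distrr; last by move=> k _; apply: integral_ge0 => w _; rewrite lee_fin.
  apply: eq_big_nat => k; rewrite ltnS => kK; rewrite -ge0_integralZl//.
  - by apply: eq_integral => w _; rewrite A'E.
  - exact/measurable_EFinP.
  - by move=> w _; rewrite lee_fin.
rewrite muleA -EFinM.
apply: le_trans (lee_wpmul2l _ sumA) _.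
  by rewrite lee_fin mulr_ge0// invr_ge0 ler0n.
(* From here the two sides are equal: writing K as the square of s = sqrt K, kappa / K becomes
   gamma0 / s and 1 / kappa becomes 1 / (gamma0 s). *)
rewrite -EFinM lee_fin le_eqVlt; apply/orP; left; apply/eqP.
have sK : K%:R = Num.sqrt K%:R ^+ 2 :> R by rewrite sqr_sqrtr// ler0n.
have rl : rho - lambda != 0 by rewrite subr_eq0 gt_eqF.
rewrite /C /c0 /kappa /v; move: sK sqrtK_gt0; move: (Num.sqrt K%:R) => s -> s_gt0.
by field; rewrite rl theta_neq0 !gt_eqF.
Qed.
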